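(* Adopt the setting of the context, including the margin condition with constants $\delta\in(0,M_p]$ and $D_L>0$, a compact set $K\subset\overline\Omega$, and the leakage constants $C_*,h_0$. Assume $0<h\le\min\{h_0,\varepsilon\}$, $\varepsilon\le1$ and $\lambda h\le2dN$. With $$D_L^h=\mathrm{dist}(\overline\Omega_{\delta/2},\mathbb R^d\setminus Q_L^h),\qquad \overline\Omega_{\delta/2}=\{x:\mathrm{dist}(x,\overline\Omega)\le\delta/2\},$$ assume $D_L^h-2h>0$ and $\exp(\lambda(D_L^h-2h)/(4dN))\ge2$. Set $$\mathfrak g^{\rm ext}:=\sup_{\mathbb R^d\setminus Q_L^h}\Gamma_{\varepsilon,h}(v_{\varepsilon,h},\bar\pi),\qquad C_{\rm ext}:=\frac{2\sqrt d\,M_b(\|f\|_\infty+M_p)}{\lambda}+2\|f\|_\infty .$$ Then $\mathfrak g^{\rm ext}\le C_{\rm ext}/(\varepsilon h)$. If moreover $$e^{-\lambda D_L/(4dN)}\le\frac{\delta h^2}{24\,C_{\rm ext}},$$ then $$0\le v_L^*(x)-v_{\varepsilon,h}(x)\le h\Bigl(\frac{\|f\|_\infty}{\lambda}+C_*\Bigr)\qquad\text{for all }x\in K.$$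
   Context: Setting. $|\cdot|$ is the Euclidean norm and $\|\cdot\|_\infty$ the pointwise supremum norm. $\Omega\subset\mathbb R^d$ is a bounded domain with $C^2$ boundary and outward unit normal $n$; $A\subset\mathbb R^m$ is compact; $\lambda>0$; $b:\mathbb R^d\times A\to\mathbb R^d$ and $f:\mathbb R^d\times A\to[0,\infty)$ are continuous, bounded, and Lipschitz in $x$ uniformly in $a$, with $\mathrm{Lip}_x(b)<\lambda$; $M_b:=\sup|b|$. There is $\nu>0$ such that for each $x\in\partial\Omega$ some $a\in A$ satisfies $b(x,a)\cdot n(x)\le-\nu$. The Hamiltonian $H(x,p)=\sup_{a\in A}\{-b(x,a)\cdot p-f(x,a)\}$ tends to $\infty$ as $|p|\to\infty$ uniformly in $x\in\overline\Omega$. For a fixed $M_p>0$, $p_\Omega(x)=\min\{\mathrm{dist}(x,\overline\Omega),M_p\}$. $N>0$ is fixed with $N\ge\frac12\sup_{x,a}\max_i|b_i(x,a)|$; $h,\varepsilon>0$. Scheme. $(\nabla_hv)_i(x)=\frac{v(x+he_i)-v(x-he_i)}{2h}$, $\Delta_hv(x)=\sum_{i=1}^d\frac{v(x+he_i)-2v(x)+v(x-he_i)}{h^2}$, $\nu_h=Nh$. A policy is a Borel map $\pi:\mathbb R^d\to A$. Set $c_\pi(x)=f(x,\pi(x))+p_\Omega(x)/\varepsilon$, $\mathcal A^\pi v=\lambda v-b(\cdot,\pi)\cdot\nabla_hv-\nu_h\Delta_hv$, $\mathcal L^\pi_{\varepsilon,h}v=\mathcal A^\pi v-c_\pi$, $\mathcal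 F_{\varepsilon,h}[v]=\lambda v+H(x,\nabla_hv)-\nu_h\Delta_hv-p_\Omega/\varepsilon$, and the greedy gap $\Gamma_{\varepsilon,h}(v,\pi)=\mathcal F_{\varepsilon,h}[v]-\mathcal L^\pi_{\varepsilon,h}v\ge0$. $S_{\varepsilon,h}(\pi)$ and $v_{\varepsilon,h}$ are the unique bounded Borel functions on $\mathbb R^d$ with $\mathcal L^\pi_{\varepsilon,h}S_{\varepsilon,h}(\pi)=0$ and $\mathcal F_{\varepsilon,h}[v_{\varepsilon,h}]=0$ pointwise. Inward feedback. Constants $r_1\in(0,1]$, $\nu_0\in(0,1]$, $C_\Omega\ge1$, a function $\tilde d\in C^{1,1}(\mathbb R^d)$ and a Borel feedback $\bar\pi:\mathbb R^d\to A$ are fixed (such objects exist because $\Omega$ is bounded with $C^2$ boundary, $b$ is continuous, and for each $x\in\partial\Omega$ some $a\in A$ satisfies $b(x,a)\cdot n(x)\le-\nu$ with $\nu>0$ independent of $x$) such that: (V1) $|\nabla\tilde d|\le1$ and $\|D^2\tilde d\|_{L^\infty}\le C_\Omega$; (V2) $\tilde d\le0$ on $\overline\Omega$ and $\tilde d(x)\ge\frac12\min\{\mathrm{dist}(x,\overline\Omega),r_1\}$ for $x\notin\overline\Omega$; (V3) $b(x,\bar\pi(x))\cdot\nabla\tilde d(x)\le-\nu_0$ whenever $|\tilde d(x)|\le r_1$. Leakage constants. $C_*\ge1$ (depending only on $\lambda,\nu_0,d,N,M_b,C_\Omega$) and $h_0\in(0,1]$ (depending additionally on $M_p,r_1$)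 are constants, which exist, such that for all $h\in(0,h_0]$ and $\varepsilon>0$, $S_{\varepsilon,h}(\bar\pi)\le\|f\|_\infty/\lambda+C_*h/\varepsilon$ on $\overline\Omega$. Boxes and localized class. $0<h<L$; $Q_L=[-L,L]^d$ contains $\overline\Omega$ in its interior; $Q_L^h=[-L+h,L-h]^d$. $\Pi_L$ is the set of Borel policies $\pi:\mathbb R^d\to A$ with $\pi=\bar\pi$ on $\mathbb R^d\setminus Q_L^h$, and $v_L^*(x)=\inf_{\pi\in\Pi_L}S_{\varepsilon,h}(\pi)(x)$. Margin condition. $K\subset\overline\Omega$ is compact, and there are $\delta\in(0,M_p]$, $D_L>0$ with $\{y\in Q_L:\mathrm{dist}(y,\mathbb R^d\setminus Q_L)\le D_L+h\}\subset\{\mathrm{dist}(\cdot,\overline\Omega)\ge\delta\}$, $\mathrm{dist}(K,\mathbb R^d\setminus Q_L)>D_L+h$, and $\{\mathrm{dist}(\cdot,\overline\Omega)\le\delta\}\subset Q_L$. *)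

(* Defs.v *)
(* Points of R^d are row vectors 'rV[R]_d;
   their library topology (sup norm) is the Euclidean one, but every distance
   or length below is written with the Euclidean norm [norm2]. *)
From HB Require Import structures.
From mathcomp Require Import all_boot all_order all_algebra.
From mathcomp Require Import all_classical all_reals all_analysis.

Set Implicit Arguments.
Unset Strict Implicit.
Unset Printing Implicit Defensive.

Import Order.TTheory GRing.Theory Num.Theory.
Import numFieldNormedType.Exports.

Local Open Scope classical_set_scope.
Local Open Scope ring_scope.

Definition dotv (R : realType) (d : nat) (u v : 'rV[R]_d) : R :=
  \sum_(i < d) u 0 i * v 0 i.

Definition norm2 (R : realType) (d : nat) (u : 'rV[R]_d) : R :=
  Num.sqrt (dotv u u).

Definition evec (R : realType) (d : nat) (i : 'I_d) : 'rV[R]_d := delta_mx 0 i.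

(* Meaningful for nonempty S (the infimum of set0 is 0). *)
Definition dist (R : realType) (d : nat) (x : 'rV[R]_d) (S : set 'rV[R]_d) : R :=
  inf [set norm2 (x - y) | y in S].

(* Extended-real valued, so that the distance from the empty set is +oo. *)
Definition edist_sets (R : realType) (d : nat) (S T : set 'rV[R]_d) : \bar R :=
  ereal_inf [set (norm2 (z.1 - z.2))%:E | z in S `*` T].

Definition dist_sets (R : realType) (d : nat) (S T : set 'rV[R]_d) : R :=
  fine (edist_sets S T).

Definition boundary (T : topologicalType) (S : set T) : set T :=
  closure S `\` interior S.

Definition borelRn (R : realType) (d : nat) :=
  g_sigma_algebraType (@open 'rV[R]_d).

Definition borel_fun (R : realType) (d : nat) (v : 'rV[R]_d -> R) : Prop :=
  measurable_fun setT (v : borelRn R d -> R).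

Definition borel_map (R : realType) (d m : nat) (g : 'rV[R]_d -> 'rV[R]_m) : Prop :=
  measurable_fun setT (g : borelRn R d -> borelRn R m).

Definition bounded_real_fun (T : Type) (R : realType) (v : T -> R) : Prop :=
  exists M : R, forall x, `|v x| <= M.

Definition partial (R : realType) (d : nat) (i : 'I_d) (g : 'rV[R]_d -> R)
    (x : 'rV[R]_d) : R := 'D_(evec R i) g x.

Definition grad (R : realType) (d : nat) (g : 'rV[R]_d -> R) (x : 'rV[R]_d)
  : 'rV[R]_d := \row_(i < d) partial i g x.

Definition C1_on (R : realType) (d : nat) (U : set 'rV[R]_d) (g : 'rV[R]_d -> R)
  : Prop :=
  forall x i, U x ->
    derivable g x (evec R i) /\ {for x, continuous (partial i g)}.

Definition C2_on (R : realType) (d : nat) (U : set 'rV[R]_d) (g : 'rV[R]_d -> R)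
  : Prop :=
  C1_on U g /\ forall i, C1_on U (partial i g).

Definition local_defining_fun (R : realType) (d : nat) (Omega : set 'rV[R]_d)
    (x0 : 'rV[R]_d) (U : set 'rV[R]_d) (phi : 'rV[R]_d -> R) : Prop :=
  [/\ open U, U x0, C2_on U phi,
      (forall x, U x -> grad phi x != 0) &
      (forall x, U x -> (Omega x <-> phi x < 0)) /\
      (forall x, U x -> (boundary Omega x <-> phi x = 0))].

Definition C2_boundary (R : realType) (d : nat) (Omega : set 'rV[R]_d) : Prop :=
  forall x0, boundary Omega x0 ->
    exists U phi, local_defining_fun Omega x0 U phi.

(* The normalized gradient of a local defining function that is negative
   inside Omega; it does not depend on the defining function. *)
Definition outward_unit_normal (R : realType) (d : nat) (Omega : set 'rV[R]_d)
    (n : 'rV[R]_d -> 'rV[R]_d) : Prop :=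
  forall x0 U phi, boundary Omega x0 -> local_defining_fun Omega x0 U phi ->
    n x0 = (norm2 (grad phi x0))^-1 *: grad phi x0.

Definition gradient_lipschitz (R : realType) (d : nat) (g : 'rV[R]_d -> R) : Prop :=
  exists k : R, forall x y, norm2 (grad g x - grad g y) <= k * norm2 (x - y).

(* C^{1,1}(R^d) *)
Definition C11 (R : realType) (d : nat) (g : 'rV[R]_d -> R) : Prop :=
  (forall x, differentiable g x) /\ gradient_lipschitz g.

(* Lebesgue-null subsets of R^d: covered by countably many cubes (center c k,
   half-side r k) of arbitrarily small total volume. *)
Definition lebesgue_null (R : realType) (d : nat) (Z : set 'rV[R]_d) : Prop :=
  forall e : R, 0 < e ->
    exists (c : nat -> 'rV[R]_d) (r : nat -> R),
      [/\ forall k, 0 <= r k,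
          Z `<=` \bigcup_k [set x | forall i, `|x 0 i - c k 0 i| <= r k] &
          forall n : nat, \sum_(k < n) (2 * r k) ^+ d <= e].

Definition hessian (R : realType) (d : nat) (g : 'rV[R]_d -> R) (x : 'rV[R]_d)
  : 'M[R]_d := \matrix_(i < d, j < d) partial i (partial j g) x.

(* ||D^2 g||_{L^oo} <= C, with the operator norm on matrices. *)
Definition hessian_Linfty_le (R : realType) (d : nat) (g : 'rV[R]_d -> R) (C : R)
  : Prop :=
  exists Z : set 'rV[R]_d, lebesgue_null Z /\
    forall x, ~ Z x ->
      (forall i j, derivable (partial j g) x (evec R i)) /\
      (forall xi : 'rV[R]_d, norm2 (xi *m hessian g x) <= C * norm2 xi).

(* Data of the control problem; b and f are only meaningful for a in ctrl. *)
Record problem (R : realType) (d m : nat) := Problem {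
  Omega : set 'rV[R]_d ;
  normal : 'rV[R]_d -> 'rV[R]_d ;
  ctrl : set 'rV[R]_m ;
  b : 'rV[R]_d -> 'rV[R]_m -> 'rV[R]_d ;
  f : 'rV[R]_d -> 'rV[R]_m -> R ;
  lam : R ;
  Mp : R ;
  visc : R (* the constant N of the artificial viscosity N h *)
}.

Definition fsup (R : realType) (d m : nat) (P : problem R d m) : R :=
  sup [set `|f P z.1 z.2| | z in setT `*` ctrl P].

Definition Mb (R : realType) (d m : nat) (P : problem R d m) : R :=
  sup [set norm2 (b P z.1 z.2) | z in setT `*` ctrl P].

Definition bmax (R : realType) (d m : nat) (P : problem R d m) : R :=
  sup [set \big[Num.max/0]_(i < d) `|b P z.1 z.2 0 i| | z in setT `*` ctrl P].

Definition lipb_bounds (R : realType) (d m : nat) (P : problem R d m) : set R :=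
  [set k | 0 <= k /\ forall x y a, ctrl P a ->
             norm2 (b P x a - b P y a) <= k * norm2 (x - y)].

Definition Lipb (R : realType) (d m : nat) (P : problem R d m) : R :=
  inf (lipb_bounds P).

Definition H (R : realType) (d m : nat) (P : problem R d m) (x p : 'rV[R]_d) : R :=
  sup [set - dotv (b P x a) p - f P x a | a in ctrl P].

Record standing (R : realType) (d m : nat) (P : problem R d m) : Prop := Standing {
  dim_gt0 : (0 < d)%N ;
  Omega_neq0 : Omega P !=set0 ;
  Omega_open : open (Omega P) ;
  Omega_connected : connected (Omega P) ;
  Omega_bounded : bounded_set (Omega P) ;
  Omega_C2 : C2_boundary (Omega P) ;
  normalP : outward_unit_normal (Omega P) (normal P) ;
  ctrl_compact : compact (ctrl P) ;
  lam_gt0 : 0 < lam P ;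
  b_continuous : {within setT `*` ctrl P, continuous (fun z => b P z.1 z.2)} ;
  f_continuous : {within setT `*` ctrl P, continuous (fun z => f P z.1 z.2)} ;
  b_bounded : exists M : R, forall x a, ctrl P a -> norm2 (b P x a) <= M ;
  f_ge0 : forall x a, ctrl P a -> 0 <= f P x a ;
  f_bounded : exists M : R, forall x a, ctrl P a -> f P x a <= M ;
  b_lipschitz : lipb_bounds P !=set0 ;
  f_lipschitz : exists k : R, forall x y a, ctrl P a ->
    `|f P x a - f P y a| <= k * norm2 (x - y) ;
  Lipb_lt : Lipb P < lam P ;
  inward_controls : exists nu : R, 0 < nu /\
    forall x, boundary (Omega P) x ->
      exists a, ctrl P a /\ dotv (b P x a) (normal P x) <= - nu ;
  H_coercive : forall M : R, exists r : R, forall x p,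
    closure (Omega P) x -> r <= norm2 p -> M <= H P x p ;
  Mp_gt0 : 0 < Mp P ;
  visc_gt0 : 0 < visc P ;
  visc_ge : 2^-1 * bmax P <= visc P
}.

Definition pOmega (R : realType) (d m : nat) (P : problem R d m) (x : 'rV[R]_d) : R :=
  Num.min (dist x (closure (Omega P))) (Mp P).

Definition gradh (R : realType) (d : nat) (h : R) (v : 'rV[R]_d -> R)
    (x : 'rV[R]_d) : 'rV[R]_d :=
  \row_(i < d) ((v (x + h *: evec R i) - v (x - h *: evec R i)) / (2 * h)).

Definition laph (R : realType) (d : nat) (h : R) (v : 'rV[R]_d -> R)
    (x : 'rV[R]_d) : R :=
  \sum_(i < d)
    (v (x + h *: evec R i) - 2 * v x + v (x - h *: evec R i)) / h ^+ 2.

Definition nuh (R : realType) (d m : nat) (P : problem R d m) (h : R) : R :=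
  visc P * h.

Definition policy (R : realType) (d m : nat) (P : problem R d m)
    (pi : 'rV[R]_d -> 'rV[R]_m) : Prop :=
  borel_map pi /\ forall x, ctrl P (pi x).

Definition cost (R : realType) (d m : nat) (P : problem R d m) (eps : R)
    (pi : 'rV[R]_d -> 'rV[R]_m) (x : 'rV[R]_d) : R :=
  f P x (pi x) + pOmega P x / eps.

Definition Aop (R : realType) (d m : nat) (P : problem R d m) (h : R)
    (pi : 'rV[R]_d -> 'rV[R]_m) (v : 'rV[R]_d -> R) (x : 'rV[R]_d) : R :=
  lam P * v x - dotv (b P x (pi x)) (gradh h v x) - nuh P h * laph h v x.

Definition Lop (R : realType) (d m : nat) (P : problem R d m) (eps h : R)
    (pi : 'rV[R]_d -> 'rV[R]_m) (v : 'rV[R]_d -> R) (x : 'rV[R]_d) : R :=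
  Aop P h pi v x - cost P eps pi x.

Definition Fop (R : realType) (d m : nat) (P : problem R d m) (eps h : R)
    (v : 'rV[R]_d -> R) (x : 'rV[R]_d) : R :=
  lam P * v x + H P x (gradh h v x) - nuh P h * laph h v x - pOmega P x / eps.

Definition greedy_gap (R : realType) (d m : nat) (P : problem R d m) (eps h : R)
    (v : 'rV[R]_d -> R) (pi : 'rV[R]_d -> 'rV[R]_m) (x : 'rV[R]_d) : R :=
  Fop P eps h v x - Lop P eps h pi v x.

(* Definite descriptions ([get] selects an element of a nonempty set). *)
Definition Sval (R : realType) (d m : nat) (P : problem R d m) (eps h : R)
    (pi : 'rV[R]_d -> 'rV[R]_m) : 'rV[R]_d -> R :=
  get [set v : 'rV[R]_d -> R |
    [/\ borel_fun v, bounded_real_fun v & forall x, Lop P eps h pi v x = 0]].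

Definition vval (R : realType) (d m : nat) (P : problem R d m) (eps h : R)
  : 'rV[R]_d -> R :=
  get [set v : 'rV[R]_d -> R |
    [/\ borel_fun v, bounded_real_fun v & forall x, Fop P eps h v x = 0]].

Record inward_feedback (R : realType) (d m : nat) (P : problem R d m)
    (r1 nu0 COmega : R) (dtil : 'rV[R]_d -> R) (pibar : 'rV[R]_d -> 'rV[R]_m)
  : Prop := InwardFeedback {
  r1_range : 0 < r1 <= 1 ;
  nu0_range : 0 < nu0 <= 1 ;
  COmega_ge1 : 1 <= COmega ;
  dtil_C11 : C11 dtil ;
  pibar_policy : policy P pibar ;
  V1_grad : forall x, norm2 (grad dtil x) <= 1 ;
  V1_hess : hessian_Linfty_le dtil COmega ;
  V2_in : forall x, closure (Omega P) x -> dtil x <= 0 ;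
  V2_out : forall x, ~ closure (Omega P) x ->
    2^-1 * Num.min (dist x (closure (Omega P))) r1 <= dtil x ;
  V3 : forall x, `|dtil x| <= r1 ->
    dotv (b P x (pibar x)) (grad dtil x) <= - nu0
}.

Record leakage_constants (R : realType) (d m : nat) (P : problem R d m)
    (pibar : 'rV[R]_d -> 'rV[R]_m) (Cstar h0 : R) : Prop := LeakageConstants {
  Cstar_ge1 : 1 <= Cstar ;
  h0_range : 0 < h0 <= 1 ;
  leakage : forall h eps : R, 0 < h -> h <= h0 -> 0 < eps ->
    forall x, closure (Omega P) x ->
      Sval P eps h pibar x <= fsup P / lam P + Cstar * h / eps
}.

(* [-l, l]^d ; thus Q_L = box d L and Q_L^h = box d (L - h). *)
Definition box (R : realType) (d : nat) (l : R) : set 'rV[R]_d :=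
  [set x | forall i, - l <= x 0 i <= l].
Arguments box {R} d l.

Definition PiL (R : realType) (d m : nat) (P : problem R d m) (h L : R)
    (pibar : 'rV[R]_d -> 'rV[R]_m) : set ('rV[R]_d -> 'rV[R]_m) :=
  [set pi | policy P pi /\ forall x, ~ box d (L - h) x -> pi x = pibar x].

Definition vLstar (R : realType) (d m : nat) (P : problem R d m) (eps h L : R)
    (pibar : 'rV[R]_d -> 'rV[R]_m) (x : 'rV[R]_d) : R :=
  inf [set Sval P eps h pi x | pi in PiL P h L pibar].

Record margin (R : realType) (d m : nat) (P : problem R d m) (h L : R)
    (K : set 'rV[R]_d) (delta DL : R) : Prop := Margin {
  delta_range : 0 < delta <= Mp P ;
  DL_gt0 : 0 < DL ;
  margin_layer :
    [set y | box d L y /\ dist y (~` box d L) <= DL + h]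
      `<=` [set y | delta <= dist y (closure (Omega P))] ;
  margin_K : ((DL + h)%:E < edist_sets K (~` box d L))%E ;
  margin_box : [set y | dist y (closure (Omega P)) <= delta] `<=` box d L
}.

Definition DLh (R : realType) (d m : nat) (P : problem R d m) (h L delta : R) : R :=
  dist_sets [set x | dist x (closure (Omega P)) <= delta / 2] (~` box d (L - h)).

(* Extended-real valued: an upper bound on it includes finiteness. *)
Definition gext (R : realType) (d m : nat) (P : problem R d m) (eps h L : R)
    (pibar : 'rV[R]_d -> 'rV[R]_m) : \bar R :=
  ereal_sup [set (greedy_gap P eps h (vval P eps h) pibar x)%:E
            | x in ~` box d (L - h)].

Definition Cext (R : realType) (d m : nat) (P : problem R d m) : R :=
  2 * Num.sqrt d%:R * Mb P * (fsup P + Mp P) / lam P + 2 * fsup P.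

(* Main.v *)
(* Over one step of the scheme the operator A^pi compares lam * v with a discounted
   random walk on the grid x + h Z^d, so it satisfies a maximum principle; this gives the
   values as fixed points of contractions, v <= S(pi), and |v| <= (|f| + Mp / eps) / lam,
   whence the bound on the greedy gap.
   For the second claim take pi almost greedy in the inner box and equal to the inward
   feedback outside it, and compare S(pi) with (1 + h) v. With G the greedy gap of pi,
   A^pi (S(pi) - (1 + h) v) = (1 + h) G - h c_pi. The gap G is negligible in the inner
   box and at most Cext / (eps h) outside it, whereas c_pi >= delta / eps outside and in a
   layer of width DL around the deep part of the box. An exponential barrier, constant in
   the deep part, absorbs the exterior gap: it is a homogeneous supersolution, and the
   error made by truncating it at depth DL - h is e^(- lam DL / (4 d N)) times the gap,
   which h c_pi dominates. So S(pi) <= (1 + h) v on K up to the greedy tolerance, and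
   v <= S(pibar) <= |f| / lam + Cstar there. *)
Require Import Defs.
From mathcomp Require Import all_boot all_order all_algebra.
From mathcomp Require Import all_classical all_reals all_analysis.
From mathcomp Require Import measurable_realfun ring lra.

Set Implicit Arguments.
Unset Strict Implicit.
Unset Printing Implicit Defensive.

Import Order.TTheory GRing.Theory Num.Theory.
Import numFieldNormedType.Exports.

Local Open Scope classical_set_scope.
Local Open Scope ring_scope.

(** * Euclidean norm and distance to a set *)

Section Euclidean.
Context {R : realType} {d : nat}.
Implicit Types (u v x y : 'rV[R]_d) (S : set 'rV[R]_d).

Lemma dotv_ge0 u : 0 <= dotv u u.
Proof. by apply: sumr_ge0 => i _; rewrite -expr2 sqr_ge0. Qed.

Lemma norm2_ge0 u : 0 <= norm2 u.
Proof. exact: sqrtr_ge0. Qed.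

Lemma sqr_norm2 u : norm2 u ^+ 2 = dotv u u.
Proof. by rewrite sqr_sqrtr ?dotv_ge0. Qed.

Lemma coord_le_norm2 u i : `|u 0 i| <= norm2 u.
Proof.
rewrite -(@ler_pXn2r _ 2) ?nnegrE ?norm2_ge0 // sqr_norm2 real_normK ?num_real //.
rewrite /dotv (bigD1 i) //= -expr2 lerDl.
by apply: sumr_ge0 => j _; rewrite -expr2 sqr_ge0.
Qed.

Lemma norm2_le_coord u e : 0 <= e -> (forall i, `|u 0 i| <= e) ->
  norm2 u <= Num.sqrt d%:R * e.
Proof.
move=> e0 ue; rewrite -(@ler_pXn2r _ 2) ?nnegrE ?norm2_ge0 //; last first.
  by rewrite mulr_ge0 ?sqrtr_ge0.
rewrite sqr_norm2 exprMn sqr_sqrtr ?ler0n //.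
apply: (@le_trans _ _ (\sum_(i < d) e ^+ 2)).
  apply: ler_sum => i _; rewrite -expr2 -[u 0 i ^+ 2]real_normK ?num_real //.
  by rewrite ler_pXn2r ?nnegrE.
by rewrite sumr_const card_ord mulr_natl.
Qed.

Lemma dotvC u v : dotv u v = dotv v u.
Proof. by apply: eq_bigr => i _; rewrite mulrC. Qed.

(** Cauchy-Schwarz, from the nonnegative squared length of |v| u - |u| v. The final division by |u|
    |v| forces the zero cases to be treated first. *)
Lemma dotv_le u v : dotv u v <= norm2 u * norm2 v.
Proof.
have dot0 (w z : 'rV[R]_d) : norm2 w = 0 -> dotv w z = 0.
  move=> w0; apply: big1 => i _; have := coord_le_norm2 w i.
  by rewrite w0 normr_le0 => /eqP ->; rewrite mul0r.
have [u0|u0] := eqVneq (norm2 u) 0; first by rewrite dot0 // u0 mul0r.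
have [v0|v0] := eqVneq (norm2 v) 0; first by rewrite dotvC dot0 // v0 mulr0.
set a := norm2 u in u0 *; set b := norm2 v in v0 *.
have ab0 : 0 < a * b by rewrite mulr_gt0 // lt_def ?u0 ?v0 norm2_ge0.
have : 0 <= \sum_(i < d) (b * u 0 i - a * v 0 i) ^+ 2.
  by apply: sumr_ge0 => i _; exact: sqr_ge0.
have -> : \sum_(i < d) (b * u 0 i - a * v 0 i) ^+ 2
        = b ^+ 2 * dotv u u - 2 * (a * b) * dotv u v + a ^+ 2 * dotv v v.
  rewrite /dotv !mulr_sumr -sumrB -big_split /=.
  by apply: eq_bigr => i _; ring.
rewrite -!sqr_norm2 -/a -/b => H.
by rewrite -(ler_pM2l ab0); nra.
Qed.

Lemma norm2N u : norm2 (- u) = norm2 u.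
Proof. by congr Num.sqrt; apply: eq_bigr => i _; rewrite !mxE mulrNN. Qed.

Lemma norm2B x y : norm2 (x - y) = norm2 (y - x).
Proof. by rewrite -norm2N opprB. Qed.

Lemma dotv_abs_le u v : `|dotv u v| <= norm2 u * norm2 v.
Proof.
rewrite ler_norml dotv_le andbT -(norm2N u) lerNl; apply: le_trans (dotv_le _ _).
by rewrite /dotv -sumrN; apply: ler_sum => i _; rewrite mxE mulNr.
Qed.

Lemma norm2D u v : norm2 (u + v) <= norm2 u + norm2 v.
Proof.
rewrite -(@ler_pXn2r _ 2) ?nnegrE ?norm2_ge0 ?addr_ge0 ?norm2_ge0 //.
rewrite sqrrD !sqr_norm2.
have -> : dotv (u + v) (u + v) = dotv u u + dotv u v *+ 2 + dotv v v.
  rewrite mulr2n /dotv -!big_split /=; apply: eq_bigr => i _; rewrite !mxE; ring.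
by rewrite lerD2r lerD2l lerMn2r /= dotv_le.
Qed.

Lemma norm2_evec t (i : 'I_d) : norm2 (t *: evec R i) = `|t|.
Proof.
rewrite -sqrtr_sqr; congr Num.sqrt; rewrite /dotv (bigD1 i) //= big1.
  by rewrite !mxE !eqxx mulr1 addr0 expr2.
by move=> j ji; rewrite !mxE (negbTE ji) andbF !mulr0.
Qed.

Lemma dist_le_norm2 x y S : S y -> dist x S <= norm2 (x - y).
Proof.
move=> Sy; apply: ge_inf; last by exists y.
by exists 0 => _ [z _ <-]; exact: norm2_ge0.
Qed.

Lemma dist_ge0 x S : 0 <= dist x S.
Proof.
have [->|/set0P[y Sy]] := eqVneq S set0.
  by rewrite /dist image_set0 inf0.
apply: lb_le_inf; first by exists (norm2 (x - y)); exists y.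
by move=> _ [z _ <-]; exact: norm2_ge0.
Qed.

Lemma dist_lipschitz x y S : `|dist x S - dist y S| <= norm2 (x - y).
Proof.
have [->|/set0P[z0 Sz0]] := eqVneq S set0.
  by rewrite /dist !image_set0 inf0 subrr normr0 norm2_ge0.
have half (u v : 'rV[R]_d) : dist u S - norm2 (u - v) <= dist v S.
  apply: lb_le_inf; first by exists (norm2 (v - z0)); exists z0.
  move=> _ [z Sz <-]; rewrite lerBlDl; apply: le_trans (dist_le_norm2 _ Sz) _.
  by rewrite -[u - z](subrKA v) norm2D.
rewrite ler_norml; apply/andP; split.
  by have := half y x; rewrite norm2B; lra.
by have := half x y; lra.
Qed.

(** Neighborhoods are given by sup-norm balls, and the Euclidean norm is at most sqrt d times the
    sup norm. *)
Lemma norm2_nbhs x e : 0 < e -> \forall y \near x, norm2 (x - y) < e.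
Proof.
(* The added 1 keeps the divisor positive even for d = 0. *)
move=> e0; set D : R := Num.sqrt d%:R + 1.
have D0 : 0 < D by rewrite ltr_wpDl ?sqrtr_ge0.
have eD0 : 0 < e / D / 2 by rewrite !divr_gt0.
apply/nbhs_ballP; exists (e / D / 2) => //= y [_ xy].
apply: (@le_lt_trans _ _ (Num.sqrt d%:R * (e / D / 2))).
  apply: norm2_le_coord => [|i]; first exact: ltW.
  by rewrite !mxE ltW //; exact: xy.
apply: (@lt_trans _ _ (D * (e / D / 2))).
  by rewrite ltr_pM2r // ltrDl.
by rewrite [ltLHS](_ : _ = e / 2); [lra|field; rewrite gt_eqF].
Qed.

Lemma lipschitz2_continuous (g : 'rV[R]_d -> R) k :
  (forall x y, `|g x - g y| <= k * norm2 (x - y)) -> continuous g.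
Proof.
move=> gk x U /nbhs_ballP[e /= e0 eU].
have k0 : 0 < `|k| + 1 by rewrite ltr_wpDl.
have ek0 : 0 < e / (`|k| + 1) by rewrite divr_gt0.
apply: filterS (norm2_nbhs x ek0) => y; rewrite ltr_pdivlMr // => H.
apply: eU; rewrite -ball_normE /=; apply: (le_lt_trans (gk _ _)); apply: le_lt_trans H.
by have := norm2_ge0 (x - y); have := ler_norm k; nra.
Qed.

End Euclidean.

(** * Borel functions and countable dense sets *)

Section Borel.
Context {R : realType} {d : nat}.
Implicit Types (v w : 'rV[R]_d -> R).

Lemma open_borel (U : set 'rV[R]_d) :
  open U -> measurable (U : set (borelRn R d)).
Proof. exact: sub_sigma_algebra. Qed.

Lemma continuous_borel v : continuous v -> borel_fun v.
Proof.
move=> /continuousP cv; apply: (measurability _ (RGenOpens.measurableE R)).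
move=> _ [_ [a [b ->] <-]]; rewrite setTI.
by apply: open_borel; apply: cv; exact: interval_open.
Qed.

Lemma continuous_borel_map n (g : 'rV[R]_d -> 'rV[R]_n) :
  continuous g -> borel_map g.
Proof.
move=> /continuousP cg.
apply: (@measurability _ _ (borelRn R d) (borelRn R n) _ g (@open 'rV[R]_n)) => //.
by move=> _ [U oU <-]; rewrite setTI; apply: open_borel; exact: cg.
Qed.

Lemma borel_fun_shift v c : borel_fun v -> borel_fun (fun x => v (x + c)).
Proof.
move=> mv; apply: (measurableT_comp mv); apply: continuous_borel_map.
move=> x U /nbhs_ballP[e /= e0 eU]; apply/nbhs_ballP; exists e => //= y [_ xy].
apply: eU; split=> // i j; rewrite -ball_normE /= !mxE opprD addrACA subrr addr0.
by have := xy i j; rewrite -ball_normE.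
Qed.

Lemma borel_fun_gt v : borel_fun v <->
  forall c, measurable ([set x | c < v x] : set (borelRn R d)).
Proof.
split=> [mv c|H].
  have := mv measurableT `]c, +oo[%classic (measurable_itv _).
  by rewrite setTI preimage_itvoy.
move=> mT; apply: (measurability _ (RGenOInfty.measurableE R)) => //.
by move=> _ [_ [c ->] <-]; rewrite setTI preimage_itvoy; exact: H.
Qed.

Lemma borel_fun_lt v : borel_fun v <->
  forall c, measurable ([set x | v x < c] : set (borelRn R d)).
Proof.
split=> [mv c|H].
  have := mv measurableT `]-oo, c[%classic (measurable_itv _).
  by rewrite setTI preimage_itvNyo.
move=> mT; apply: (measurability _ (RGenInftyO.measurableE R)) => //.
by move=> _ [_ [c ->] <-]; rewrite setTI preimage_itvNyo; exact: H.
Qed.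

Lemma rat_dense_norm2 (x : 'rV[R]_d) e : 0 < e ->
  exists q : 'rV[rat]_d, norm2 (x - map_mx ratr q) < e.
Proof.
move=> e0; have /nbhs_ballP[r r0 xr] := norm2_nbhs x e0.
have r0' : 0 < r by [].
have H i : exists q : rat, ratr q \in `]x 0 i - r, x 0 i + r[.
  by apply: rat_in_itvoo; rewrite ltrBlDr -addrA ltrDl addr_gt0.
pose q i := projT1 (cid (H i)).
exists (\row_i q i); apply: xr; split => // i j.
rewrite !mxE /q; case: cid => /= s; rewrite in_itv/= => /andP[s1 s2].
rewrite -ball_normE /= ltr_distl (ord1 i).
by apply/andP; split; lra.
Qed.

End Borel.

(** Each ball with rational center and radius 1 / (n + 1) that meets A contributes one of its
    points. If 1 / (n + 1) < e / 2, the ball around a rational point close to x yields a point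
    within e of x. *)
Lemma countable_dense_subset (R : realType) (m : nat) (A : set 'rV[R]_m) :
  A !=set0 -> exists a : nat -> 'rV[R]_m, (forall k, A (a k)) /\
    forall x (e : R), A x -> 0 < e -> exists k, norm2 (x - a k) < e.
Proof.
move=> [a0 Aa0].
pose near_q (p : 'rV[rat]_m * nat) :=
  [set y | A y /\ norm2 (y - map_mx ratr p.1) < p.2.+1%:R^-1].
(* The default [a0] lies in A, so the selected point is in A also when the ball misses A. *)
pose c p := xget a0 (near_q p).
have Ac p : A (c p).
  by rewrite /c; case: xgetP => // y _ [].
exists (fun k => if unpickle k is Some p then c p else a0); split=> [k|x e Ax e0].
  by case: unpickle.
have [n] : exists n : nat, 0 + n.+1%:R^-1 < e / 2.
  by apply: ltr_add_invr; rewrite divr_gt0.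
rewrite add0r => ne.
have n0 : 0 < n.+1%:R^-1 :> R by rewrite invr_gt0 ltr0Sn.
have [q xq] := rat_dense_norm2 x n0.
exists (pickle (q, n)); rewrite pickleK.
have [_ cq] : near_q (q, n) (c (q, n)).
  by apply: xgetPex; exists x.
rewrite -(subrKA (map_mx ratr q)); apply: (le_lt_trans (norm2D _ _)).
rewrite [norm2 (_ - c _)]norm2B; move: cq xq ne => /=.
by set r := _^-1; lra.
Qed.

Lemma within_continuous_gt (R : realType) (m : nat) (A : set 'rV[R]_m)
    (g : 'rV[R]_m -> R) x c :
  {within A, continuous g} -> A x -> c < g x ->
  exists2 e, 0 < e & forall y, A y -> norm2 (x - y) < e -> c < g y.
Proof.
move=> /subspace_continuousP cg Ax cgx.
have : nbhs (g x) [set r | c < r].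
  by apply: open_nbhs_nbhs; split => //; exact: open_gt.
move=> /(cg x Ax) /= /nbhs_ballP[e e0 eA]; exists e => // y Ay xy.
apply: eA => //; split => // i j; rewrite (ord1 i) -ball_normE /=.
by apply: le_lt_trans xy; have := coord_le_norm2 (x - y) j; rewrite !mxE.
Qed.

(* Since g is uniformly Lipschitz in x, its sublevel sets are countable unions, over
   rational centers and radii, of balls intersected with preimages under pi of relatively
   open sets; no Borel structure on the product is needed. *)
Lemma borel_fun_policy (R : realType) (d m : nat) (A : set 'rV[R]_m)
    (g : 'rV[R]_d -> 'rV[R]_m -> R) (k : R) (pi : 'rV[R]_d -> 'rV[R]_m) :
  borel_map pi -> (forall x, A (pi x)) ->
  (forall x, {within A, continuous (g x)}) ->
  (forall x y a, A a -> `|g x a - g y a| <= k * norm2 (x - y)) ->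
  borel_fun (fun x => g x (pi x)).
Proof.
move=> mpi Api cg gk; apply/borel_fun_lt => c.
pose K : R := `|k| + 1.
have K0 : 0 < K by rewrite ltr_wpDl.
have gK x y a : A a -> `|g x a - g y a| <= K * norm2 (x - y).
  move=> Aa; apply: (le_trans (gk _ _ _ Aa)); rewrite ler_wpM2r ?norm2_ge0 //.
  by have := ler_norm k; rewrite /K; lra.
pose F (p : 'rV[rat]_d * nat) := [set x : 'rV[R]_d |
  norm2 (x - map_mx ratr p.1) < p.2.+1%:R^-1] `&`
  pi @^-1` ([set a | g (map_mx ratr p.1) a < c - K * p.2.+1%:R^-1] `&` A).
rewrite (_ : [set x | _] = \bigcup_p F p).
  apply: countable_bigcupT_measurable => [|[q n]].
    by exact: countableP.
  apply: (@measurableI _ (borelRn R d)).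
    apply: (borel_fun_lt _).1; apply: continuous_borel.
    apply: (@lipschitz2_continuous _ _ _ 1) => x y; rewrite mul1r ler_norml.
    have H (u v : 'rV[R]_d) : norm2 (u - map_mx ratr q) <=
        norm2 (u - v) + norm2 (v - map_mx ratr q).
      by rewrite -[u - map_mx ratr q](subrKA v) norm2D.
    by have := H x y; have := H y x; rewrite (norm2B y x); lra.
  have /continuousP/(_ [set r | r < c - K * n.+1%:R^-1]) := cg (map_mx ratr q).
  move=> /(_ (@open_lt R _))/open_subspaceP[V oV /= VA].
  rewrite -VA (_ : pi @^-1` (V `&` A) = setT `&` pi @^-1` V); last first.
    by apply/seteqP; split=> x /= [].
  by apply: mpi => //; exact: open_borel.
apply/seteqP; split=> [x /= gx|x [[q n] _ [/= xq [gq _]]]]; last first.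
  have := gK x (map_mx ratr q) _ (Api x); rewrite ler_norml => /andP[_ H].
  have := ltr_pM2l K0 (norm2 (x - map_mx ratr q)) (n.+1%:R^-1); rewrite xq.
  by move: H gq; set X := K * _; set Y := K * _ => ? ? ?; lra.
have [n] : exists n : nat, 0 + n.+1%:R^-1 < (c - g x (pi x)) / (K * 2).
  by apply: ltr_add_invr; rewrite divr_gt0 ?subr_gt0 ?mulr_gt0.
rewrite add0r ltr_pdivlMr ?mulr_gt0 // => nc.
have n0 : 0 < n.+1%:R^-1 :> R by rewrite invr_gt0 ltr0Sn.
have [q xq] := rat_dense_norm2 x n0.
exists (q, n) => //; split => //=; split; last exact: Api.
have := gK x (map_mx ratr q) _ (Api x); rewrite ler_norml => /andP[H _].
have := ltr_pM2l K0 (norm2 (x - map_mx ratr q)) (n.+1%:R^-1); rewrite xq.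
move: nc; rewrite (mulrC _ (K * 2)) (mulrC K 2) -mulrA.
by move: H; set X := K * _; set Y := K * _ => ? ? ?; lra.
Qed.

(** * Fixed points and comparison for contractions *)

Section FixedPoint.
Context {R : realType} {d : nat}.
Implicit Types u v w : 'rV[R]_d -> R.

(** Banach iteration from 0, with the limit taken pointwise because Borel measurability passes to
    pointwise limits. The one-sided hypothesis on [T] includes monotonicity (e = 0) and, used in
    both directions, gives the sup-norm contraction. *)
Lemma contraction_borel_fixpoint
    (T : ('rV[R]_d -> R) -> 'rV[R]_d -> R) (q M : R) :
  0 <= q < 1 ->
  (forall u, borel_fun u -> borel_fun (T u)) ->
  (forall u w e, (forall x, u x <= w x + e) -> forall x, T u x <= T w x + q * e) ->
  (forall x, `|T (cst 0) x| <= M) ->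
  exists v, [/\ borel_fun v, bounded_real_fun v & forall x, T v x = v x].
Proof.
move=> /andP[q0 q1] mT Tq TM.
have Tabs u w e : (forall x, `|u x - w x| <= e) ->
    forall x, `|T u x - T w x| <= q * e.
  move=> uw x; rewrite ler_norml; apply/andP; split.
    rewrite lerBrDl; have : T w x <= T u x + q * e; last lra.
    by apply: Tq => y; have := uw y; rewrite ler_norml; lra.
  rewrite lerBlDl; apply: Tq => y.
  by have := uw y; rewrite ler_norml; lra.
pose u n := iter n T (cst 0).
(* The solution of M + q C = C, so that all iterates stay in the ball of radius [C]. *)
pose C := M / (1 - q).
have q1' : 0 < 1 - q by rewrite subr_gt0.
have CE : M + q * C = C by rewrite /C; field; rewrite gt_eqF.
have M0 : 0 <= M by apply: le_trans (TM 0).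
have C0 : 0 <= C by rewrite /C divr_ge0 // ltW.
have uC n x : `|u n x| <= C.
  elim: n x => [|n IH] x; first by rewrite /u /= normr0.
  have : `|T (u n) x - T (cst 0) x| <= q * C.
    by apply: Tabs => y; rewrite subr0.
  by move: (TM x) CE; rewrite -[u n.+1 x]/(T (u n) x) !ler_norml; lra.
have ucauchy n k x : `|u (n + k)%N x - u n x| <= q ^+ n * C.
  elim: n x => [|n IH] x.
    by rewrite expr0 mul1r add0n subr0.
  by rewrite addSn exprS -mulrA; exact: Tabs.
have qC e : 0 < e -> exists n, q ^+ n * C < e.
  move=> e0; have : q ^+ n * C @[n --> \oo] --> 0.
    rewrite -[X in _ --> X](mul0r C); apply: cvgMl; apply: cvg_expr.
    by rewrite ger0_norm.
  move=> /cvgrPdist_lt/(_ e e0)[N _ H]; exists N.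
  have := H N (leqnn N); rewrite sub0r normrN; apply: le_lt_trans.
  exact: ler_norm.
have ucvg x : cvgn (u ^~ x).
  apply: cauchy_cvg; apply/cauchyP => e e0; have [n nC] := qC e e0.
  exists (u n x); exists n => // k /= nk; rewrite -ball_normE /= distrC.
  by rewrite -(subnKC nk); apply: le_lt_trans nC.
pose v x := limn (u ^~ x).
have uv n x : `|v x - u n x| <= q ^+ n * C.
  apply/ler_addgt0Pr => e e0; have /cvgrPdist_lt/(_ e e0)[N _ H] := ucvg x.
  have := H (n + N)%N (leq_addl _ _); have := ucauchy n N x.
  by rewrite -/(v x) ltr_norml !ler_norml; lra.
exists v; split.
- apply: (@measurable_fun_cvg _ (borelRn R d) R setT u) => [n|x _]; last exact: ucvg.
  by elim: n => [|n IH]; [exact: measurable_cst|exact: mT].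
- exists C => x; apply/ler_addgt0Pr => e e0; have [n nC] := qC e e0.
  have := uv n x; have := uC n x; rewrite !ler_norml.
  by move: nC; set X := q ^+ n * C; lra.
- move=> x; apply/eqP; rewrite -subr_eq0 -normr_le0; apply/ler_addgt0Pr => e e0.
  have [n nC] := qC (e / 2) (divr_gt0 e0 (ltr0Sn R 1)).
  have := Tabs v (u n) (q ^+ n * C) (uv n) x; have := uv n.+1 x.
  rewrite exprS -mulrA -[u n.+1 x]/(T (u n) x) !ler_norml.
  have : q * (q ^+ n * C) <= q ^+ n * C.
    by apply: ler_piMl; [apply: mulr_ge0 => //; exact: exprn_ge0|exact: ltW].
  by move: nC; set X := q ^+ n * C; set Y := q * X; lra.
Qed.

End FixedPoint.

(** Abstract maximum principle: iterating the improvement from the initial bound gives z <= q^n |M|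
    for every n. It is applied to differences of sub- and supersolutions. *)
Lemma contraction_le0 (R : realType) (T : Type) (z : T -> R) (q : R) :
  0 <= q < 1 -> (exists M, forall x, z x <= M) ->
  (forall e, 0 <= e -> (forall x, z x <= e) -> forall x, z x <= q * e) ->
  forall x, z x <= 0.
Proof.
move=> /andP[q0 q1] [M zM] H x.
have zn n y : z y <= q ^+ n * `|M|.
  elim: n y => [|n IH] y; first by rewrite mul1r (le_trans (zM y)) ?ler_norm.
  by rewrite exprS -mulrA; apply: H => //; rewrite mulr_ge0 ?exprn_ge0.
apply/ler_addgt0Pr => e e0; rewrite add0r.
have : q ^+ n * `|M| @[n --> \oo] --> 0.
  rewrite -[X in _ --> X](mul0r `|M|); apply: cvgMl; apply: cvg_expr.
  by rewrite ger0_norm.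
move=> /cvgrPdist_lt/(_ e e0)[N _ /(_ N (leqnn N))].
rewrite sub0r normrN => /ltW /(le_trans (ler_norm _)); exact: le_trans.
Qed.

(** Comparison with the zero function: |v| <= V + e yields |F v| <= (1 - q) V + q (V + e) = V + q
    e. *)
Lemma contraction_fixpoint_bound (R : realType) (T : Type)
    (F : (T -> R) -> T -> R) (q V : R) (v : T -> R) :
  0 <= q < 1 ->
  (forall u w e, (forall x, u x <= w x + e) -> forall x, F u x <= F w x + q * e) ->
  (forall x, `|F (cst 0) x| <= (1 - q) * V) -> bounded_real_fun v ->
  (forall x, F v x = v x) -> forall x, `|v x| <= V.
Proof.
move=> q01 Fq F0 [M vM] Fv x; rewrite -subr_le0.
apply: (@contraction_le0 _ _ (fun x => `|v x| - V) q) => {x} //.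
  by exists (M - V) => x; rewrite lerD2r.
move=> e e0 He x; have := F0 x.
have H1 : F v x <= F (cst 0) x + q * (V + e).
  by apply: Fq => y /=; have := He y; have := ler_norm (v y); lra.
have H2 : F (cst 0) x <= F v x + q * (V + e).
  apply: Fq => y /=; have := He y; have := ler_norm (- v y); rewrite normrN; lra.
move: H1 H2; rewrite Fv => H1 H2; rewrite ler_norml lerBlDr ler_norml; lra.
Qed.

(** * Bounds and measurability of the data and the Hamiltonian *)

Section Problem.
Context {R : realType} {d m : nat} (P : problem R d m) (hP : standing P).
Implicit Types (x y p : 'rV[R]_d) (a : 'rV[R]_m) (u v w : 'rV[R]_d -> R).

Lemma norm2_b_le_Mb x a : ctrl P a -> norm2 (b P x a) <= Mb P.
Proof.
move=> Aa; apply: ub_le_sup; last by exists (x, a).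
by have [M bM] := b_bounded hP; exists M => _ [[y c] [_ Ac] <-]; exact: bM.
Qed.

Lemma normf_le_fsup x a : ctrl P a -> `|f P x a| <= fsup P.
Proof.
move=> Aa; apply: ub_le_sup; last by exists (x, a).
have [M fM] := f_bounded hP; exists M => _ [[y c] [_ Ac] <-] /=.
by rewrite ger0_norm; [exact: fM|exact: (f_ge0 hP)].
Qed.

Lemma f_le_fsup x a : ctrl P a -> f P x a <= fsup P.
Proof. by move=> Aa; apply: le_trans (normf_le_fsup x Aa); exact: ler_norm. Qed.

(** The lower bound on the viscosity constant, in the form that makes the weights of the scheme
    nonnegative. *)
Lemma b_coord_le_visc x a i : ctrl P a -> `|b P x a 0 i| <= 2 * visc P.
Proof.
move=> Aa; have : `|b P x a 0 i| <= bmax P; last by have := visc_ge hP; lra.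
apply: (@le_trans _ _ (\big[Num.max/0]_(j < d) `|b P x a 0 j|)).
  exact: le_bigmax_cond.
apply: ub_le_sup; last by exists (x, a).
have [M bM] := b_bounded hP; exists M => _ [[y c] [_ Ac] <-] /=.
apply/bigmax_leP; split=> [|j _]; first exact: le_trans (norm2_ge0 _) (bM y c Ac).
exact: le_trans (coord_le_norm2 _ _) (bM y c Ac).
Qed.

Lemma b_lipschitz_coord : exists k : R, forall x y a i, ctrl P a ->
  `|b P x a 0 i - b P y a 0 i| <= k * norm2 (x - y).
Proof.
have [k [k0 bk]] := b_lipschitz hP; exists k => x y a i Aa.
apply: le_trans (bk x y a Aa).
by have := coord_le_norm2 (b P x a - b P y a) i; rewrite !mxE.
Qed.

Lemma pOmega_ge0 x : 0 <= pOmega P x.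
Proof. by rewrite le_min dist_ge0 ltW ?(Mp_gt0 hP). Qed.

Lemma pOmega_le_Mp x : pOmega P x <= Mp P.
Proof. by rewrite ge_min lexx orbT. Qed.

Lemma borel_pOmega : borel_fun (pOmega P).
Proof.
apply: (@measurable_minr _ (borelRn R d)); last exact: measurable_cst.
apply: continuous_borel; apply: (@lipschitz2_continuous _ _ _ 1) => x y.
by rewrite mul1r dist_lipschitz.
Qed.

Lemma within_b_f_continuous x :
  (forall i, {within ctrl P, continuous (fun a => b P x a 0 i)}) /\
  {within ctrl P, continuous (f P x)}.
Proof.
have xcvg a : ctrl P a ->
    (fun c => (x, c)) @ within (ctrl P) (nbhs a) -->
    within (setT `*` ctrl P) (nbhs (x, a)).
  move=> Aa U [[V W] /= [Vx Wa] VWU]; rewrite /= nbhs_simpl /=.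
  apply: filterS Wa => c Wc Ac; apply: (VWU (x, c)) => //=; split => //=.
  exact: nbhs_singleton Vx.
split=> [i|]; apply/subspace_continuousP => a Aa.
  have /subspace_continuousP/(_ (x, a)) bc := b_continuous hP.
  apply: (cvg_comp (fun c => b P x c) (fun v : 'rV[R]_d => v 0 i)).
    exact: (cvg_comp (fun c => (x, c)) (fun z => b P z.1 z.2) (xcvg a Aa) (bc _)).
  exact: coord_continuous.
have /subspace_continuousP/(_ (x, a)) fc := f_continuous hP.
exact: (cvg_comp (fun c => (x, c)) (fun z => f P z.1 z.2) (xcvg a Aa) (fc _)).
Qed.

Definition control_gain x p a : R := - dotv (b P x a) p - f P x a.

Lemma control_gain_le_H x p a : ctrl P a -> control_gain x p a <= H P x p.
Proof.
move=> Aa; apply: ub_le_sup; last by exists a.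
exists (Mb P * norm2 p) => _ [c Ac <-].
have := f_ge0 hP x Ac; have := dotv_abs_le (b P x c) p.
have := norm2_b_le_Mb x Ac; rewrite ler_norml; have := norm2_ge0 p; nra.
Qed.

Lemma H_le x p c : ctrl P !=set0 ->
  (forall a, ctrl P a -> control_gain x p a <= c) -> H P x p <= c.
Proof.
move=> [a0 A0] Hc; apply: ge_sup; first by exists (control_gain x p a0); exists a0.
by move=> _ [a Aa <-]; exact: Hc.
Qed.

Lemma within_control_gain_continuous x p :
  {within ctrl P, continuous (control_gain x p)}.
Proof.
have [bc fc] := within_b_f_continuous x.
apply/subspace_continuousP => a Aa; apply: cvgB.
  apply: cvgN; rewrite /dotv; apply: cvg_big => [|i _]; first exact: add_continuous.
  apply: cvgMl.
  by have /subspace_continuousP := bc i; exact.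
by have /subspace_continuousP := fc; exact.
Qed.

Lemma borel_cost eps pi : policy P pi -> borel_fun (cost P eps pi).
Proof.
move=> [mpi Api]; apply: (@measurable_funD _ (borelRn R d)).
  have [k fk] := f_lipschitz hP.
  apply: (@borel_fun_policy _ _ _ (ctrl P) _ k) => // x.
  by have [_] := within_b_f_continuous x.
by apply: (@measurable_funM _ (borelRn R d));
  [exact: borel_pOmega|exact: measurable_cst].
Qed.

Lemma borel_b_coord pi i : policy P pi -> borel_fun (fun x => b P x (pi x) 0 i).
Proof.
move=> [mpi Api]; have [k bk] := b_lipschitz_coord.
apply: (@borel_fun_policy _ _ _ (ctrl P) (fun x a => b P x a 0 i) k) => // x.
  by have [] := within_b_f_continuous x.
by move=> y a Aa; exact: bk.
Qed.

Lemma borel_control_gain (g : 'rV[R]_d -> 'rV[R]_d) a : ctrl P a ->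
  (forall i, borel_fun (fun x => g x 0 i)) ->
  borel_fun (fun x => control_gain x (g x) a).
Proof.
move=> Aa mg; apply: (@measurable_funB _ (borelRn R d)).
  apply: (@measurable_funN _ (borelRn R d)).
  apply: (@measurable_sum _ (borelRn R d)) => i.
  apply: (@measurable_funM _ (borelRn R d)); last exact: mg.
  have [k bk] := b_lipschitz_coord.
  by apply: continuous_borel; apply: (@lipschitz2_continuous _ _ _ k) => x y; exact: bk.
have [k fk] := f_lipschitz hP.
by apply: continuous_borel; apply: (@lipschitz2_continuous _ _ _ k) => x y; exact: fk.
Qed.

(** The gain is continuous on the control set, so a countable dense sequence already approaches the
    supremum. Measurability of the Hamiltonian and the Borel choice of almost greedy controls thus
    reduce to countable set operations. *)
Lemma near_optimal_control (s : nat -> 'rV[R]_m) : ctrl P !=set0 ->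
  (forall a (e : R), ctrl P a -> 0 < e -> exists k, norm2 (a - s k) < e) ->
  (forall k, ctrl P (s k)) ->
  forall x p c, c < H P x p -> exists k, c < control_gain x p (s k).
Proof.
move=> A0 sdense As x p c cH.
have [a [Aa ca]] : exists a, ctrl P a /\ c < control_gain x p a.
  apply: contrapT => /forallNP H; move: cH; apply/negP; rewrite -leNgt.
  apply: H_le => // a Aa; rewrite leNgt; apply/negP => ca.
  by apply: (H a).
have [e e0 He] := within_continuous_gt (@within_control_gain_continuous x p) Aa ca.
by have [k ak] := sdense a e Aa e0; exists k; apply: He.
Qed.

Lemma borel_H (g : 'rV[R]_d -> 'rV[R]_d) : ctrl P !=set0 ->
  (forall i, borel_fun (fun x => g x 0 i)) -> borel_fun (fun x => H P x (g x)).
Proof.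
move=> A0 mg; have [s [As sdense]] := countable_dense_subset A0.
apply/borel_fun_gt => c.
rewrite (_ : [set x | _] = \bigcup_k [set x | c < control_gain x (g x) (s k)]).
  apply: (@bigcup_measurable _ (borelRn R d)) => k _.
  by apply: (borel_fun_gt _).1; exact: borel_control_gain.
apply/seteqP; split=> x /=; last first.
  by move=> [k _ /=] ck; apply: lt_le_trans ck _; exact: control_gain_le_H.
by move=> /(near_optimal_control A0 sdense As)[k]; exists k.
Qed.

(** * The scheme as a random walk on the grid *)

Definition transition (h : R) u x a : R :=
  \sum_(i < d) ((visc P / h + b P x a 0 i / (2 * h)) * u (x + h *: evec R i)
               + (visc P / h - b P x a 0 i / (2 * h)) * u (x - h *: evec R i)).

(** Total weight of the 2 d neighbors in [transition]; the drift parts of opposite directions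
    cancel. *)
Definition jump_rate (h : R) : R := 2 * d%:R * visc P / h.

Context (h eps : R) (h_gt0 : 0 < h) (eps_gt0 : 0 < eps).
Let rate := jump_rate h.

Lemma transitionE u x a : dotv (b P x a) (gradh h u x) + nuh P h * laph h u x =
  transition h u x a - rate * u x.
Proof.
rewrite /transition /laph /dotv /nuh mulr_sumr -big_split /=.
have -> : rate * u x = \sum_(i < d) (2 * visc P / h * u x).
  rewrite sumr_const card_ord -mulr_natl /rate /jump_rate.
  by field; rewrite gt_eqF.
by rewrite -sumrB; apply: eq_bigr => i _; rewrite mxE; field; rewrite gt_eqF.
Qed.

Definition neighbor x y : Prop :=
  exists i, y = x + h *: evec R i \/ y = x - h *: evec R i.

(** The weights (2 N + b_i) / (2 h) and (2 N - b_i) / (2 h) are nonnegative since |b_i| <= 2 N. Only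
    the values at the neighbors matter, which allows local comparisons for the barrier. *)
Lemma transition_le u w x a e : ctrl P a ->
  (forall y, neighbor x y -> u y <= w y + e) ->
  transition h u x a <= transition h w x a + rate * e.
Proof.
move=> Aa uw; have -> : rate * e = \sum_(i < d) (2 * visc P / h * e).
  rewrite sumr_const card_ord -mulr_natl /rate /jump_rate.
  by field; rewrite gt_eqF.
rewrite -big_split /=; apply: ler_sum => i _.
have up : u (x + h *: evec R i) <= w (x + h *: evec R i) + e.
  by apply: uw; exists i; left.
have um : u (x - h *: evec R i) <= w (x - h *: evec R i) + e.
  by apply: uw; exists i; right.
have /ler_normlP[b1 b2] := b_coord_le_visc x i Aa.
have w1 : 0 <= visc P / h + b P x a 0 i / (2 * h).
  have -> : visc P / h + b P x a 0 i / (2 * h) =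
      (2 * visc P + b P x a 0 i) / (2 * h) by field; rewrite gt_eqF.
  by apply: divr_ge0; [lra|rewrite mulr_ge0 ?ltW].
have w2 : 0 <= visc P / h - b P x a 0 i / (2 * h).
  have -> : visc P / h - b P x a 0 i / (2 * h) =
      (2 * visc P - b P x a 0 i) / (2 * h) by field; rewrite gt_eqF.
  by apply: divr_ge0; [lra|rewrite mulr_ge0 ?ltW].
have -> : 2 * visc P / h * e = (visc P / h + b P x a 0 i / (2 * h)) * e +
    (visc P / h - b P x a 0 i / (2 * h)) * e by field; rewrite gt_eqF.
have := ler_wpM2l w1 up; have := ler_wpM2l w2 um; rewrite !mulrDr; lra.
Qed.

Lemma transition_cst x a c : transition h (cst c) x a = rate * c.
Proof.
rewrite /transition /rate /jump_rate.
rewrite (eq_bigr (fun=> 2 * visc P / h * c)) => [|i _ /=].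
  by rewrite sumr_const card_ord -mulr_natl; field; rewrite gt_eqF.
by field; rewrite gt_eqF.
Qed.

Lemma transition_ub u x a e : ctrl P a -> (forall y, neighbor x y -> u y <= e) ->
  transition h u x a <= rate * e.
Proof.
move=> Aa ue.
have ue' y : neighbor x y -> u y <= (cst 0 : 'rV[R]_d -> R) y + e.
  by move=> xy; rewrite add0r; exact: ue.
by have := transition_le Aa ue'; rewrite transition_cst mulr0 add0r.
Qed.

Lemma transition_lin u w x a (s t c : R) :
  transition h (fun y => s * u y + t * w y + c) x a =
  s * transition h u x a + t * transition h w x a + rate * c.
Proof.
rewrite -(transition_cst x a) /transition !mulr_sumr -!big_split /=.
by apply: eq_bigr => i _; ring.
Qed.

Lemma rate_gt0 : 0 < rate.
Proof.
by rewrite /rate /jump_rate divr_gt0 ?mulr_gt0 ?(visc_gt0 hP) ?ltr0n ?(dim_gt0 hP).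
Qed.

(** [Lam] is the coefficient of u x in A^pi u, and [q] is the discount factor of one jump, below 1
    because the discount rate is positive. *)
Let Lam := lam P + rate.
Let q := rate / Lam.

Lemma Lam_gt0 : 0 < Lam.
Proof. by rewrite addr_gt0 ?rate_gt0 ?(lam_gt0 hP). Qed.

Lemma q_lt1 : 0 <= q < 1.
Proof.
rewrite /q divr_ge0 ?ltW ?rate_gt0 ?Lam_gt0 //= ltr_pdivrMr ?Lam_gt0 // mul1r.
by rewrite ltrDr (lam_gt0 hP).
Qed.

Lemma AopE pi u x : Aop P h pi u x = Lam * u x - transition h u x (pi x).
Proof.
have := transitionE u x (pi x); rewrite /Aop /Lam; lra.
Qed.

(** If u - w <= e everywhere, then Lam (u - w) <= rate e at each point, which improves the bound to
    q e. *)
Lemma policy_comparison pi u w :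
  policy P pi -> bounded_real_fun u -> bounded_real_fun w ->
  (forall x, Aop P h pi u x <= Aop P h pi w x) -> forall x, u x <= w x.
Proof.
move=> [_ Api] [M uM] [M' wM] Auw x; rewrite -subr_le0.
apply: (@contraction_le0 _ _ (fun x => u x - w x) q q_lt1) => {x}.
  exists (M + M') => x; have := ler_norm (u x); have := ler_norm (- w x).
  by rewrite normrN; have := uM x; have := wM x; lra.
move=> e e0 H x; have := Auw x; rewrite !AopE.
have : transition h u x (pi x) <= transition h w x (pi x) + rate * e.
  by apply: transition_le => // y _; have := H y; lra.
rewrite /q [_ / Lam * e]mulrAC ler_pdivlMr ?Lam_gt0 //; lra.
Qed.

(** * One-step maps, existence of the values and their comparison *)

Definition policy_step pi u x : R :=
  (cost P eps pi x + transition h u x (pi x)) / Lam.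

(** The Bellman equation solved for its diagonal term: [rate * u x] cancels the contribution of u x
    to the discrete Laplacian, so only neighbor values remain. *)
Definition bellman_step u x : R :=
  (pOmega P x / eps - H P x (gradh h u x) + nuh P h * laph h u x + rate * u x) / Lam.

Lemma policy_step_fixed pi u x : policy_step pi u x = u x <-> Lop P eps h pi u x = 0.
Proof.
rewrite /policy_step /Lop AopE; have L0 := Lam_gt0.
split=> [/(canRL (divfK _))|Lu]; first by rewrite gt_eqF // => /(_ isT); lra.
by apply: (mulIf (lt0r_neq0 L0)); rewrite divfK ?gt_eqF //; lra.
Qed.

Lemma bellman_step_fixed u x : bellman_step u x = u x <-> Fop P eps h u x = 0.
Proof.
rewrite /bellman_step /Fop; have L0 := Lam_gt0.
split=> [/(canRL (divfK _))|Lu].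
  by rewrite gt_eqF // => /(_ isT); rewrite /Lam; lra.
apply: (mulIf (lt0r_neq0 L0)); rewrite divfK ?gt_eqF // /Lam; lra.
Qed.

Lemma policy_step_le pi u w e : policy P pi ->
  (forall x, u x <= w x + e) -> forall x, policy_step pi u x <= policy_step pi w x + q * e.
Proof.
move=> [_ Api] uw x; rewrite /policy_step /q [_ / Lam * e]mulrAC -mulrDl.
rewrite ler_pM2r ?invr_gt0 ?Lam_gt0 //.
by have := transition_le (x := x) (Api x) (fun y _ => uw y); lra.
Qed.

(** The step is an infimum over controls of steps that are each monotone, so the estimate is checked
    control by control. *)
Lemma bellman_step_le u w e : ctrl P !=set0 ->
  (forall x, u x <= w x + e) -> forall x, bellman_step u x <= bellman_step w x + q * e.
Proof.
move=> A0 uw x; rewrite /bellman_step /q [_ / Lam * e]mulrAC -mulrDl.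
rewrite ler_pM2r ?invr_gt0 ?Lam_gt0 //.
set lw := nuh P h * laph h w x; set lu := nuh P h * laph h u x.
suff : H P x (gradh h w x) <=
  H P x (gradh h u x) - lu - rate * u x + lw + rate * w x + rate * e by lra.
apply: H_le => // a Aa; have := control_gain_le_H x (gradh h u x) Aa.
have := transition_le Aa (fun y (_ : neighbor x y) => uw y).
have := transitionE u x a; have := transitionE w x a.
rewrite /control_gain -/lu -/lw; lra.
Qed.

Lemma borel_translates u (i : 'I_d) : borel_fun u ->
  borel_fun (fun x => u (x + h *: evec R i)) /\
  borel_fun (fun x => u (x - h *: evec R i)).
Proof. by move=> mu; split; exact: borel_fun_shift. Qed.

Lemma borel_policy_step pi u : policy P pi -> borel_fun u ->
  borel_fun (policy_step pi u).
Proof.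
move=> Ppi mu; apply: (@measurable_funM _ (borelRn R d)); last exact: measurable_cst.
apply: (@measurable_funD _ (borelRn R d)); first exact: borel_cost.
apply: (@measurable_sum _ (borelRn R d)) => i.
have [mup mum] := borel_translates i mu.
have mb : borel_fun (fun x => b P x (pi x) 0 i / (2 * h)).
  apply: (@measurable_funM _ (borelRn R d)); last exact: measurable_cst.
  exact: borel_b_coord.
apply: (@measurable_funD _ (borelRn R d)).
  apply: (@measurable_funM _ (borelRn R d)); last exact: mup.
  by apply: (@measurable_funD _ (borelRn R d)); [exact: measurable_cst|exact: mb].
apply: (@measurable_funM _ (borelRn R d)); last exact: mum.
by apply: (@measurable_funB _ (borelRn R d)); [exact: measurable_cst|exact: mb].
Qed.

Lemma borel_gradh u i : borel_fun u -> borel_fun (fun x => gradh h u x 0 i).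
Proof.
move=> mu; have [mup mum] := borel_translates i mu.
rewrite /borel_fun; under eq_fun do rewrite mxE.
apply: (@measurable_funM _ (borelRn R d)); last exact: measurable_cst.
exact: (@measurable_funB _ (borelRn R d)).
Qed.

Lemma borel_bellman_step u : ctrl P !=set0 -> borel_fun u ->
  borel_fun (bellman_step u).
Proof.
move=> A0 mu; apply: (@measurable_funM _ (borelRn R d)); last exact: measurable_cst.
apply: (@measurable_funD _ (borelRn R d)); last first.
  by apply: (@measurable_funM _ (borelRn R d)); [exact: measurable_cst|exact: mu].
apply: (@measurable_funD _ (borelRn R d)).
  apply: (@measurable_funB _ (borelRn R d)).
    apply: (@measurable_funM _ (borelRn R d)); last exact: measurable_cst.
    exact: borel_pOmega.
  by apply: borel_H => // i; exact: borel_gradh.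
apply: (@measurable_funM _ (borelRn R d)); first exact: measurable_cst.
apply: (@measurable_sum _ (borelRn R d)) => i.
have [mup mum] := borel_translates i mu.
apply: (@measurable_funM _ (borelRn R d)); last exact: measurable_cst.
apply: (@measurable_funD _ (borelRn R d)); last exact: mum.
apply: (@measurable_funB _ (borelRn R d)); first exact: mup.
by apply: (@measurable_funM _ (borelRn R d)); [exact: measurable_cst|exact: mu].
Qed.

(** The largest possible running cost, discounted over an infinite horizon. *)
Definition value_bound : R := (fsup P + Mp P / eps) / lam P.

Lemma value_boundE : (1 - q) * value_bound = (fsup P + Mp P / eps) / Lam.
Proof.
rewrite /value_bound /q; have := Lam_gt0; have := lam_gt0 hP.
by rewrite /Lam => ? ?; field; rewrite !gt_eqF.
Qed.

Lemma pOmega_div_bounds x : 0 <= pOmega P x / eps <= Mp P / eps.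
Proof.
by rewrite ler_pM2r ?invr_gt0 // pOmega_le_Mp divr_ge0 ?pOmega_ge0 ?ltW.
Qed.

Lemma policy_step0 pi x : policy P pi ->
  `|policy_step pi (cst 0) x| <= (1 - q) * value_bound.
Proof.
move=> [_ Api]; rewrite value_boundE /policy_step /transition big1; last first.
  by move=> i _ /=; rewrite !mulr0 addr0.
rewrite addr0 normrM [`|Lam^-1|]gtr0_norm ?invr_gt0 ?Lam_gt0 //.
rewrite ler_pM2r ?invr_gt0 ?Lam_gt0 // /cost.
have /andP[p1 p2] := pOmega_div_bounds x.
have f1 := f_ge0 hP x (Api x); have f2 := f_le_fsup x (Api x).
by rewrite ger0_norm ?addr_ge0 // lerD.
Qed.

Lemma bellman_step0 x : ctrl P !=set0 ->
  `|bellman_step (cst 0) x| <= (1 - q) * value_bound.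
Proof.
move=> A0; rewrite value_boundE /bellman_step.
have -> : gradh h (cst 0 : 'rV[R]_d -> R) x = 0.
  by apply/rowP => i; rewrite !mxE /= subrr mul0r.
have -> : laph h (cst 0 : 'rV[R]_d -> R) x = 0.
  by apply: big1 => i _ /=; rewrite mulr0 subrr add0r mul0r.
rewrite /= !mulr0 !addr0 normrM [`|Lam^-1|]gtr0_norm ?invr_gt0 ?Lam_gt0 //.
rewrite ler_pM2r ?invr_gt0 ?Lam_gt0 //.
have /andP[p1 p2] := pOmega_div_bounds x.
have dot0 a : dotv (b P x a) 0 = 0.
  by apply: big1 => i _; rewrite mxE mulr0.
have [a Aa] := A0.
have := control_gain_le_H x 0 Aa; have := f_le_fsup x Aa.
have : H P x 0 <= 0.
  apply: H_le => // c Ac; rewrite /control_gain dot0.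
  by have := f_ge0 hP x Ac; lra.
rewrite /control_gain dot0 ler_norml; lra.
Qed.

(** The value is chosen from the set of solutions, so it has their properties once the contraction
    shows that set to be inhabited. *)
Lemma Sval_spec pi : policy P pi ->
  [/\ borel_fun (Sval P eps h pi), bounded_real_fun (Sval P eps h pi) &
      forall x, Lop P eps h pi (Sval P eps h pi) x = 0].
Proof.
move=> Ppi; apply: (@getPex _ (fun v => [/\ borel_fun v, bounded_real_fun v &
  forall x, Lop P eps h pi v x = 0])).
have [|||v [mv bv Fv]] := @contraction_borel_fixpoint R d (policy_step pi) q
    ((1 - q) * value_bound) q_lt1.
- by move=> u; exact: borel_policy_step.
- by move=> u w e; exact: policy_step_le.
- by move=> x; exact: policy_step0.
by exists v; split => // x; apply/policy_step_fixed.
Qed.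

Lemma vval_spec : ctrl P !=set0 ->
  [/\ borel_fun (vval P eps h), bounded_real_fun (vval P eps h) &
      forall x, Fop P eps h (vval P eps h) x = 0].
Proof.
move=> A0; apply: (@getPex _ (fun v => [/\ borel_fun v, bounded_real_fun v &
  forall x, Fop P eps h v x = 0])).
have [|||v [mv bv Fv]] := @contraction_borel_fixpoint R d bellman_step q
    ((1 - q) * value_bound) q_lt1.
- by move=> u; exact: borel_bellman_step.
- by move=> u w e; exact: bellman_step_le.
- by move=> x; exact: bellman_step0.
by exists v; split => // x; apply/bellman_step_fixed.
Qed.

Lemma vval_bound x : ctrl P !=set0 -> `|vval P eps h x| <= value_bound.
Proof.
move=> A0; have [_ bv Fv] := vval_spec A0.
apply: (contraction_fixpoint_bound q_lt1 _ _ bv _) x => [u w e|x|x].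
- exact: bellman_step_le.
- exact: bellman_step0.
- exact/bellman_step_fixed.
Qed.

Lemma greedy_gapE v pi x : greedy_gap P eps h v pi x =
  H P x (gradh h v x) - control_gain x (gradh h v x) (pi x).
Proof. by rewrite /greedy_gap /Fop /Lop /Aop /cost /control_gain; ring. Qed.

(** The gain of pi is at most the Hamiltonian, so S(pi) is a supersolution of the Bellman equation:
    one Bellman step does not increase it. *)
Lemma vval_le_Sval pi x : policy P pi -> vval P eps h x <= Sval P eps h pi x.
Proof.
move=> Ppi; have A0 : ctrl P !=set0 by exists (pi 0); exact: Ppi.2.
have [_ [M vM] Fv] := vval_spec A0; have [_ [M' SM] LS] := Sval_spec Ppi.
set v := vval P eps h in vM Fv *; set S := Sval P eps h pi in SM LS *.
rewrite -subr_le0.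
apply: (@contraction_le0 _ _ (fun x => v x - S x) q q_lt1) => {x}.
  exists (M + M') => x; have := ler_norm (v x); have := ler_norm (- S x).
  by rewrite normrN; have := vM x; have := SM x; lra.
move=> e e0 He x; have vS y : v y <= S y + e by have := He y; lra.
have := bellman_step_le A0 vS x; rewrite (bellman_step_fixed v x).2 //.
suff : bellman_step S x <= S x by lra.
rewrite /bellman_step ler_pdivrMr ?Lam_gt0 // /Lam.
have := LS x; have := control_gain_le_H x (gradh h S x) (Ppi.2 x).
rewrite /Lop /Aop /cost /control_gain; lra.
Qed.

Lemma fsup_ge0 : ctrl P !=set0 -> 0 <= fsup P.
Proof. by move=> [a Aa]; exact: le_trans (normr_ge0 _) (normf_le_fsup 0 Aa). Qed.

Lemma Mb_ge0 : ctrl P !=set0 -> 0 <= Mb P.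
Proof. by move=> [a Aa]; exact: le_trans (norm2_ge0 _) (norm2_b_le_Mb 0 Aa). Qed.

Lemma Cext_ge0 : ctrl P !=set0 -> 0 <= Cext P.
Proof.
move=> A0; have F0 := fsup_ge0 A0; have l0 := lam_gt0 hP; have p0 := Mp_gt0 hP.
apply: addr_ge0; last exact: mulr_ge0.
apply: divr_ge0; last exact: ltW.
apply: mulr_ge0; last by apply: addr_ge0 => //; exact: ltW.
by apply: mulr_ge0; [rewrite mulr_ge0 ?sqrtr_ge0|exact: Mb_ge0].
Qed.

(** Each centered difference is at most 2 V / (2 h); this is the source of the factor 1 / h in the
    gap bound. *)
Lemma norm2_gradh_vval x : ctrl P !=set0 ->
  norm2 (gradh h (vval P eps h) x) <= Num.sqrt d%:R * (value_bound / h).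
Proof.
move=> A0; have vV y := vval_bound y A0.
have V0 : 0 <= value_bound := le_trans (normr_ge0 _) (vV 0).
apply: norm2_le_coord => [|i]; first by rewrite divr_ge0 // ltW.
rewrite mxE normrM [`|(2 * h)^-1|]gtr0_norm ?invr_gt0 ?mulr_gt0 //.
rewrite ler_pdivrMr ?mulr_gt0 // [value_bound / h * _]mulrCA divfK ?gt_eqF //.
apply: le_trans (ler_normB _ _) _.
have := vV (x + h *: evec R i); have := vV (x - h *: evec R i); lra.
Qed.

(** The Hamiltonian is at most Mb |p|, and the gain of pi at least - Mb |p| - |f|; then |p| is
    bounded through the value bound. *)
Lemma greedy_gap_vval_le pi x : policy P pi -> h <= 1 -> eps <= 1 ->
  greedy_gap P eps h (vval P eps h) pi x <= Cext P / (eps * h).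
Proof.
move=> Ppi h1 eps1; have A0 : ctrl P !=set0 by exists (pi 0); exact: Ppi.2.
rewrite greedy_gapE; set p := gradh _ _ _; set V := value_bound.
have M0 := Mb_ge0 A0; have F0 := fsup_ge0 A0.
have np : norm2 p <= Num.sqrt d%:R * (V / h) := norm2_gradh_vval x A0.
(* As eps <= 1, the term |f| can also be divided by eps. *)
have Vle : V <= (fsup P + Mp P) / lam P / eps.
  rewrite /V /value_bound mulrAC ler_pM2r ?invr_gt0 ?(lam_gt0 hP) //.
  by rewrite mulrDl lerD2r ler_pdivlMr // ler_piMr.
have bp a : ctrl P a -> `|dotv (b P x a) p| <= Mb P * norm2 p.
  move=> Aa; apply: le_trans (dotv_abs_le _ _) _.
  by rewrite ler_wpM2r ?norm2_ge0 // norm2_b_le_Mb.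
have gap_le : H P x p - control_gain x p (pi x) <= 2 * (Mb P * norm2 p) + fsup P.
  have : H P x p <= Mb P * norm2 p.
    apply: H_le => // a Aa; have := bp a Aa; have := f_ge0 hP x Aa.
    by rewrite /control_gain ler_norml; lra.
  have := bp _ (Ppi.2 x); have := f_le_fsup x (Ppi.2 x).
  by rewrite /control_gain ler_norml; lra.
apply: (le_trans gap_le); rewrite /Cext [leRHS]mulrDl; apply: lerD; last first.
  rewrite ler_pdivlMr ?mulr_gt0 //.
  have : eps * h <= 1 by rewrite mulr_ile1 // ltW.
  by nra.
have -> : 2 * Num.sqrt d%:R * Mb P * (fsup P + Mp P) / lam P / (eps * h) =
    2 * (Mb P * (Num.sqrt d%:R * ((fsup P + Mp P) / lam P / eps / h))).
  by have := lam_gt0 hP => ?; field; rewrite !gt_eqF.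
rewrite ler_pM2l //; apply: ler_wpM2l => //; apply: le_trans np _.
by apply: ler_wpM2l; [exact: sqrtr_ge0|rewrite ler_pM2r ?invr_gt0].
Qed.

End Problem.

(** * Boxes as sup-norm balls and the distance to their complement *)

Section SupNorm.
Context {R : realType} {d : nat}.
Implicit Types (x y : 'rV[R]_d).

Definition supnorm x : R := \big[Num.max/0]_(i < d) `|x 0 i|.

Lemma coord_le_supnorm x i : `|x 0 i| <= supnorm x.
Proof. exact: (le_bigmax_cond _ (fun j => `|x 0 j|)). Qed.

Lemma supnorm_le x (c : R) : 0 <= c -> (forall i, `|x 0 i| <= c) -> supnorm x <= c.
Proof. by move=> c0 xc; apply/bigmax_leP; split. Qed.

Lemma supnorm_ge0 x : 0 <= supnorm x.
Proof. by rewrite /supnorm; elim/big_rec: _ => // i y _ y0; rewrite le_max y0 orbT. Qed.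

Lemma supnorm_gt x (c : R) : 0 <= c -> c < supnorm x -> exists i, c < `|x 0 i|.
Proof.
move=> c0 cx; apply: contrapT => /forallNP H.
move: cx; apply/negP; rewrite -leNgt; apply: supnorm_le => // i.
by rewrite leNgt; apply/negP; exact: H.
Qed.

Lemma supnorm_le_norm2 x y : supnorm x <= supnorm y + norm2 (x - y).
Proof.
apply: supnorm_le => [|i]; first by rewrite addr_ge0 ?supnorm_ge0 ?norm2_ge0.
have := coord_le_supnorm y i; have := coord_le_norm2 (x - y) i; rewrite !mxE.
by have := ler_normD (x 0 i - y 0 i) (y 0 i); rewrite subrK; lra.
Qed.

Lemma boxE (l : R) : 0 <= l -> box d l = [set x | supnorm x <= l].
Proof.
move=> l0; apply/seteqP; split=> x /= H.
  by apply: supnorm_le => // i; rewrite ler_norml.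
by move=> i; rewrite -ler_norml (le_trans (coord_le_supnorm x i)).
Qed.

Lemma measurable_box (l : R) : 0 <= l ->
  measurable (box d l : set (borelRn R d)).
Proof.
move=> l0; rewrite -[box d l]setCK; apply: (@measurableC _ (borelRn R d)).
rewrite boxE // (_ : ~` _ = [set x | l < supnorm x]); last first.
  by apply/seteqP; split=> x /=; rewrite ltNge => /negP.
apply: (borel_fun_gt _).1; apply: continuous_borel.
apply: (@lipschitz2_continuous _ _ _ 1) => x y; rewrite mul1r ler_norml.
by have := supnorm_le_norm2 x y; have := supnorm_le_norm2 y x; rewrite norm2B; lra.
Qed.

(** Pushing one coordinate away from 0 increases its absolute value by the full Euclidean length of
    the step; this links Euclidean margins to sup-norm depths. *)
Lemma exit_box_along_axis y i (t L : R) : 0 <= t -> L < `|y 0 i| + t ->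
  exists z, ~ box d L z /\ norm2 (y - z) = t.
Proof.
move=> t0 Ly; pose s : R := if 0 <= y 0 i then t else - t.
have s_abs : `|s| = t by rewrite /s; case: ifP => _; rewrite ?normrN ger0_norm.
exists (y + s *: evec R i); split; last first.
  by rewrite opprD addNKr norm2N norm2_evec.
move=> /(_ i); rewrite !mxE !eqxx mulr1 /s; move: Ly.
by case: ifP => [y0|/negbT]; [rewrite ger0_norm //|rewrite -ltNge => y0; rewrite ltr0_norm //]; lra.
Qed.

Lemma dist_setC_box_le y (L : R) : (0 < d)%N -> 0 <= L -> supnorm y <= L ->
  dist y (~` box d L) <= L - supnorm y.
Proof.
move=> d0 L0 yL; apply/ler_addgt0Pr => e e0.
have [i iy] : exists i, supnorm y - e < `|y 0 i|.
  (* [supnorm_gt] requires a nonnegative threshold; below zero any coordinate qualifies, and one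
     exists as d > 0. *)
  have [e1|e1] := leP e (supnorm y).
    by apply: supnorm_gt; lra.
  by exists (Ordinal d0); have := normr_ge0 (y 0 (Ordinal d0)); lra.
have [|| z [zL <-]] := @exit_box_along_axis y i (L - supnorm y + e) L; [lra|lra|].
exact: dist_le_norm2.
Qed.

End SupNorm.

(** From e^(-t) >= 1 - t, since (1 - t) (1 + 2 t) >= 1 on [0, 1/2]. *)
Lemma expR_le_1D2x (R : realType) (t : R) : 0 <= t <= 2^-1 -> expR t <= 1 + 2 * t.
Proof.
move=> /andP[t0 t1]; have := expR_ge1Dx (- t); rewrite expRN => H.
have e0 := expR_gt0 t; rewrite -(@ler_pM2l _ (expR t)^-1) ?invr_gt0 //.
rewrite mulVf ?gt_eqF //; nra.
Qed.

(** * Borel selection of an almost greedy policy *)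

Section Greedy.
Context {R : realType} {d m : nat} (P : problem R d m) (hP : standing P).
Context (h eps L eta : R) (h_gt0 : 0 < h) (eps_gt0 : 0 < eps) (hL : h < L).
Context (pibar : 'rV[R]_d -> 'rV[R]_m) (Ppibar : policy P pibar).

(** In the inner box, take the first member of a dense sequence of controls whose gain is within eta
    of the Hamiltonian; elsewhere keep the inward feedback. *)
Lemma near_greedy_policy : 0 < eta -> exists2 pi, PiL P h L pibar pi &
  forall x, box d (L - h) x -> greedy_gap P eps h (vval P eps h) pi x <= eta.
Proof.
move=> eta0; have A0 : ctrl P !=set0 by exists (pibar 0); exact: Ppibar.2.
have [mv _ _] := vval_spec hP h_gt0 eps_gt0 A0.
set v := vval P eps h in mv *; pose p x := gradh h v x.
have [s [As sdense]] := countable_dense_subset A0.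
have mp i : borel_fun (fun x => p x 0 i) by exact: borel_gradh.
pose good x k := `[< H P x (p x) - eta < control_gain P x (p x) (s k) >].
have exgood x : exists k, good x k.
  have [|k kx] := near_optimal_control hP A0 sdense As (x := x) (p := p x)
    (c := H P x (p x) - eta); first by rewrite ltrBlDr ltrDl.
  by exists k; apply/asboolP.
pose kx x := ex_minn (exgood x).
pose pi x := if pselect (box d (L - h) x) then s (kx x) else pibar x.
have mgood k : measurable ([set x | good x k] : set (borelRn R d)).
  rewrite (_ : mkset _ =
      [set x | - eta < control_gain P x (p x) (s k) - H P x (p x)]).
    apply: (borel_fun_gt _).1; apply: (@measurable_funB _ (borelRn R d)).
      exact: borel_control_gain.
    exact: borel_H.
  by apply/seteqP; split=> x /=; [move/asboolP|move=> ?; apply/asboolP]; lra.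
(* The least good index is k exactly when k is good and no smaller index is. *)
have mkx k : measurable ([set x | kx x = k] : set (borelRn R d)).
  rewrite (_ : mkset _ = [set x | good x k] `\`
      \bigcup_(j in [set j | (j < k)%N]) [set x | good x j]).
    apply: (@measurableD _ (borelRn R d)) => //.
    by apply: (@bigcup_measurable _ (borelRn R d)).
  apply/seteqP; split=> x /=; rewrite /kx; case: ex_minnP => n gn nmin.
    move=> <-; split=> // -[j /= jn] /nmin; by rewrite leqNgt jn.
  move=> [gk nk]; apply/eqP; rewrite eqn_leq nmin //= leqNgt; apply/negP => nk'.
  by apply: nk; exists n.
have mbox : measurable (box d (L - h) : set (borelRn R d)).
  by apply: measurable_box; rewrite subr_ge0 ltW.
exists pi; first split; first split.
- move=> _ U mU; rewrite setTI (_ : pi @^-1` U =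
      (~` box d (L - h) `&` pibar @^-1` U) `|` (box d (L - h) `&`
        \bigcup_(k in [set k | U (s k)]) [set x | kx x = k])).
    apply: (@measurableU _ (borelRn R d)).
      apply: (@measurableI _ (borelRn R d)).
        exact: (@measurableC _ (borelRn R d)).
      by rewrite -[_ @^-1` _]setTI; exact: Ppibar.1.
    apply: (@measurableI _ (borelRn R d)) => //.
    exact: (@bigcup_measurable _ (borelRn R d)).
  apply/seteqP; split=> x /=; rewrite /pi; case: pselect => bx /=.
  + by move=> Us; right; split=> //; exists (kx x).
  + by move=> Ux; left.
  + by move=> [[]//|[_ [k /= Usk ->]]].
  + by move=> [[]//|[]//].
- by move=> x; rewrite /pi; case: pselect => bx /=; [exact: As|exact: Ppibar.2].
- by move=> x bx; rewrite /pi; case: pselect.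
move=> x bx; rewrite greedy_gapE -/(p x) /pi; case: pselect => /= [_|//].
by rewrite /kx; case: ex_minnP => k /asboolP gk _; lra.
Qed.

End Greedy.

(** * The exponential barrier *)

Section Barrier.
Context {R : realType} {d m : nat} (P : problem R d m) (hP : standing P).
Context (h eps L delta DL : R) (h_gt0 : 0 < h) (eps_gt0 : 0 < eps) (hL : h < L).
Context (K : set 'rV[R]_d) (hmargin : margin P h L K delta DL).
Context (hlam : lam P * h <= 2 * d%:R * visc P).
Implicit Types (x y : 'rV[R]_d) (pi : 'rV[R]_d -> 'rV[R]_m).

(** Decay rate for which rate (1 + 2 kappa h) = lam + rate exactly. *)
Let kappa : R := lam P / (4 * d%:R * visc P).
Let rate := jump_rate P h.
(** Sup-norm distance to the faces of the inner box from inside, and 0 outside that box. *)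
Let depth x : R := Num.max 0 (L - h - supnorm x).
Let E : R := expR (- (kappa * (DL - h))).

(** Frozen one step before depth DL, so that a point deeper than DL has all its neighbors in the
    flat region. *)
Definition barrier x : R := expR (- (kappa * Num.min (depth x) (DL - h))).

Let dN_gt0 : 0 < d%:R * visc P.
Proof. by rewrite mulr_gt0 ?(visc_gt0 hP) ?ltr0n ?(dim_gt0 hP). Qed.

Lemma kappa_gt0 : 0 < kappa.
Proof. by rewrite divr_gt0 ?(lam_gt0 hP) // -mulrA mulr_gt0. Qed.

Lemma kappa_h : 0 <= kappa * h <= 2^-1.
Proof.
rewrite mulr_ge0 ?(ltW kappa_gt0) ?(ltW h_gt0) //= /kappa.
rewrite [_ / _ * h]mulrAC -[4 * _ * _]mulrA ler_pdivrMr; last by apply: mulr_gt0.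
by move: hlam; rewrite -mulrA; set X := d%:R * visc P; lra.
Qed.

Lemma rate_expR_kappa : rate * expR (kappa * h) <= lam P + rate.
Proof.
have r0 : 0 < rate := rate_gt0 hP h_gt0.
apply: (@le_trans _ _ (rate * (1 + 2 * (kappa * h)))).
  by rewrite ler_pM2l // expR_le_1D2x // kappa_h.
rewrite le_eqVlt; apply/orP; left; apply/eqP.
rewrite /rate /jump_rate /kappa; field.
have d0 := dim_gt0 hP; have v0 := visc_gt0 hP.
by rewrite !gt_eqF ?ltr0n.
Qed.

Lemma supnorm_neighbor x y : neighbor h x y -> supnorm y <= supnorm x + h.
Proof.
move=> xy; apply: le_trans (supnorm_le_norm2 y x) _; rewrite lerD2l.
by case: xy => i [->|->]; rewrite addrC addKr ?norm2N norm2_evec gtr0_norm.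
Qed.

Lemma depth_neighbor x y : neighbor h x y -> depth x <= depth y + h.
Proof.
move=> /supnorm_neighbor xy; rewrite /depth ge_max; apply/andP; split.
  by rewrite addr_ge0 ?le_max ?lexx // ltW.
have : L - h - supnorm y <= Num.max 0 (L - h - supnorm y) by rewrite le_max lexx orbT.
by lra.
Qed.

Lemma barrier_neighbor x y : neighbor h x y -> barrier y <= expR (kappa * h) * barrier x.
Proof.
move=> /depth_neighbor xy; rewrite /barrier -expRD ler_expR.
have : Num.min (depth x) (DL - h) <= Num.min (depth y) (DL - h) + h.
  by have h0 := h_gt0; rewrite !minEle; do 2!case: ifPn; rewrite -?ltNge; lra.
by have := kappa_gt0; nra.
Qed.

Lemma barrier_gt0 x : 0 < barrier x.
Proof. exact: expR_gt0. Qed.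

Lemma barrier_deep x : DL - h <= depth x -> barrier x = E.
Proof. by move=> Dx; rewrite /barrier min_r. Qed.

Lemma depth_ge0 x : 0 <= depth x.
Proof. by rewrite le_max lexx. Qed.

Lemma barrier_le_surface x y : depth x = 0 -> barrier y <= barrier x.
Proof.
move=> x0; rewrite /barrier ler_expR lerN2 ler_pM2l ?kappa_gt0 // x0.
by rewrite le_min ge_min depth_ge0 ge_min lexx orbT.
Qed.

Lemma barrier_bounded : bounded_real_fun barrier.
Proof.
exists (expR (- (kappa * Num.min 0 (DL - h)))) => x.
rewrite ger0_norm ?(ltW (barrier_gt0 x)) // /barrier ler_expR lerN2 ler_pM2l ?kappa_gt0 //.
by rewrite le_min ge_min depth_ge0 ge_min lexx orbT.
Qed.

(** One step multiplies the barrier by at most e^(kappa h), and rate e^(kappa h) <= lam + rate; the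
    truncation preserves this. *)
Lemma Aop_barrier_ge0 pi x : policy P pi -> 0 <= Aop P h pi barrier x.
Proof.
move=> Ppi; rewrite AopE // subr_ge0.
apply: le_trans (transition_ub hP h_gt0 (Ppi.2 x) (@barrier_neighbor x)) _.
by rewrite mulrA ler_pM2r ?barrier_gt0 // rate_expR_kappa.
Qed.

(** At a maximum over the stencil the walk returns at most rate times the value, which leaves the
    discount term. This serves outside the inner box, where the barrier is maximal, and in the flat
    region. *)
Lemma Aop_barrier_locally_max pi x : policy P pi ->
  (forall y, neighbor h x y -> barrier y <= barrier x) ->
  lam P * barrier x <= Aop P h pi barrier x.
Proof.
move=> Ppi xmax; rewrite AopE //.
have := transition_ub hP h_gt0 (Ppi.2 x) xmax; lra.
Qed.

Lemma depth_outside x : ~ box d (L - h) x -> depth x = 0.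
Proof.
rewrite boxE ?subr_ge0 ?ltW //= => /negP; rewrite -ltNge => xL.
by apply/max_idPl; lra.
Qed.

(** The inner box is smaller than Q_L by h, so depth at most DL inside Q_L means distance at most DL
    + h to its complement, where the margin layer applies. Outside Q_L, [margin_box] gives the
    bound. *)
Lemma dist_shallow x : depth x <= DL -> delta <= dist x (closure (Omega P)).
Proof.
have h0 := h_gt0; have hL' := hL.
move=> Dx; have [xL|xL] := pselect (box d L x); last first.
  rewrite leNgt; apply/negP => /ltW xd.
  by apply: xL; exact: (margin_box hmargin).
apply: (margin_layer hmargin); split=> //=.
have L0 : 0 <= L by lra.
have xL' : supnorm x <= L by move: xL; rewrite boxE.
apply: le_trans (dist_setC_box_le (dim_gt0 hP) L0 xL') _.
by move: Dx; rewrite /depth ge_max => /andP[_]; lra.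
Qed.

Lemma cost_shallow pi x : policy P pi -> depth x <= DL ->
  delta / eps <= cost P eps pi x.
Proof.
move=> Ppi /dist_shallow xd; have := f_ge0 hP x (Ppi.2 x).
have : delta / eps <= pOmega P x / eps.
  rewrite ler_pM2r ?invr_gt0 // le_min xd.
  by have /andP[] := delta_range hmargin.
by rewrite /cost; lra.
Qed.

(** Otherwise a step of length DL + h along an axis would leave Q_L, against the strict margin of
    K. *)
Lemma depth_K x : K x -> DL - h <= depth x.
Proof.
have h0 := h_gt0; have hL' := hL; have D0 := DL_gt0 hmargin.
move=> Kx; rewrite /depth le_max; apply/orP; right.
rewrite leNgt; apply/negP => xD.
have [LD|LD] := leP 0 (L - DL).
  have [i xi] : exists i, L - DL < `|x 0 i| by apply: supnorm_gt; lra.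
  have [|| z [zL xz]] := @exit_box_along_axis _ _ x i (DL + h) L; [lra|lra|].
  have := margin_K hmargin; rewrite ltNge => /negP; apply.
  by apply: ereal_inf_lbound; exists (x, z); rewrite //= xz.
have i0 := Ordinal (dim_gt0 hP).
have [||z [zL xz]] := @exit_box_along_axis _ _ x i0 (DL + h) L; [lra| |].
  by have := normr_ge0 (x 0 i0); lra.
have := margin_K hmargin; rewrite ltNge => /negP; apply.
by apply: ereal_inf_lbound; exists (x, z); rewrite //= xz.
Qed.

(** * Comparison of the almost greedy value with (1 + h) v *)

Context (pibar : 'rV[R]_d -> 'rV[R]_m) (Ppibar : policy P pibar).
Context (h1 : h <= 1) (eps1 : eps <= 1).
Context (small : expR (- (lam P * DL / (4 * d%:R * visc P)))
                 <= delta * h ^+ 2 / (24 * Cext P)).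

(** Bound for (1 + h) times the greedy gap outside the inner box. *)
Let X : R := (1 + h) * (Cext P / (eps * h)).

(** Division by 0 gives 0, so Cext = 0 would place a positive exponential below 0 in [small]. *)
Lemma Cext_gt0 : 0 < Cext P.
Proof.
have A0 : ctrl P !=set0 by exists (pibar 0); exact: Ppibar.2.
rewrite lt_def Cext_ge0 // andbT; apply/eqP => C0.
by move: small; rewrite C0 mulr0 invr0 mulr0 leNgt expR_gt0.
Qed.

Lemma X_gt0 : 0 < X.
Proof. by rewrite mulr_gt0 ?addr_gt0 // divr_gt0 ?Cext_gt0 ?mulr_gt0. Qed.

(** The penalty pays for the truncation: e^(kappa h) <= 2 makes up for freezing at DL - h instead of
    DL, 1 + h <= 2, and the constant 24 leaves the factor 4 / 24 = 1/6. *)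
Lemma X_E_le : X * E <= h * (delta / eps).
Proof.
have C0 := Cext_gt0; have /andP[d0 _] := delta_range hmargin.
have E_le : E <= 2 * (delta * h ^+ 2 / (24 * Cext P)).
  rewrite /E mulrBr opprB expRD; apply: ler_pM; rewrite ?expR_ge0 //.
    have /andP[k0 k1] := kappa_h.
    by apply: le_trans (expR_le_1D2x _) _; rewrite ?k0 ?k1 //; lra.
  by rewrite /kappa mulrAC.
apply: (@le_trans _ _ (2 * (Cext P / (eps * h)) * (2 * (delta * h ^+ 2 / (24 * Cext P))))).
  apply: ler_pM => //; [exact/ltW/X_gt0|exact: expR_ge0|].
  by rewrite /X ler_pM2r; [move: h1; lra|apply: divr_gt0 => //; exact: mulr_gt0].
have -> : 2 * (Cext P / (eps * h)) * (2 * (delta * h ^+ 2 / (24 * Cext P))) =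
    6^-1 * (h * (delta / eps)) by field; rewrite !gt_eqF.
have : 0 < h * (delta / eps) by rewrite mulr_gt0 ?divr_gt0.
by lra.
Qed.

(** The function (1 + h) v + (X / lam) (barrier - E) + (1 + h) eta / lam is a supersolution for pi,
    and its barrier term vanishes on K. *)
Lemma near_greedy_value eta pi x : 0 < eta -> PiL P h L pibar pi ->
  (forall y, box d (L - h) y -> greedy_gap P eps h (vval P eps h) pi y <= eta) ->
  K x -> Sval P eps h pi x <= (1 + h) * vval P eps h x + (1 + h) * eta / lam P.
Proof.
move=> eta0 [Ppi _] Hgap Kx.
have A0 : ctrl P !=set0 by exists (pibar 0); exact: Ppibar.2.
have [_ bv Fv] := vval_spec hP h_gt0 eps_gt0 A0.
have [_ bS LS] := Sval_spec hP h_gt0 eps_gt0 Ppi.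
have l0 := lam_gt0 hP; have X0 := X_gt0; have h0 := h_gt0.
set v := vval P eps h in Hgap bv Fv *; set S := Sval P eps h pi in bS LS *.
pose c := (1 + h) * eta / lam P - X / lam P * E.
pose w y := (1 + h) * v y + X / lam P * barrier y + c.
have -> : (1 + h) * v x + (1 + h) * eta / lam P = w x.
  by rewrite /w /c barrier_deep ?depth_K //; lra.
apply: (policy_comparison hP h_gt0 Ppi bS) => {x Kx} [|x].
  have [M vM] := bv; have [M' bM'] := barrier_bounded.
  exists ((1 + h) * M + X / lam P * M' + `|c|) => x.
  apply: le_trans (ler_normD _ _) _; rewrite lerD2r.
  apply: le_trans (ler_normD _ _) _.
  have Xl : 0 < X / lam P by rewrite divr_gt0.
  rewrite [`|(1 + h) * _|]normrM [`|X / lam P * _|]normrM.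
  rewrite (gtr0_norm Xl) (@gtr0_norm _ (1 + h)) ?addr_gt0 //.
  by apply: lerD; rewrite ler_wpM2l // ltW ?addr_gt0.
have Aw : Aop P h pi w x = (1 + h) * Aop P h pi v x +
    X / lam P * Aop P h pi barrier x + (1 + h) * eta - X * E.
  rewrite !AopE // /w transition_lin // /c.
  by rewrite -/rate; field; rewrite gt_eqF.
set G := greedy_gap P eps h v pi x.
have Av : Aop P h pi v x = cost P eps pi x - G.
  by rewrite /G /greedy_gap Fv /Lop; ring.
have AS : Aop P h pi S x = cost P eps pi x.
  by apply/eqP; rewrite -subr_eq0 -[X in X == _]/(Lop P eps h pi S x) LS.
rewrite AS Aw Av; set T := X / lam P * _.
(* [T] absorbs the exterior gap, eta the interior one, and - X E, the price of subtracting E, is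
   paid by the cost or by [T]. *)
suff : (1 + h) * G <= h * cost P eps pi x + T + (1 + h) * eta - X * E by lra.
have XE := X_E_le.
have T_ge (b : R) : lam P * b <= Aop P h pi barrier x -> X * b <= T.
  move=> lb; rewrite /T [X / _ * _]mulrAC ler_pdivlMr // -mulrA ler_pM2l //.
  by rewrite mulrC.
have T0 : 0 <= T by rewrite mulr_ge0 ?Aop_barrier_ge0 ?divr_ge0 // ltW.
have hcost : depth x <= DL -> h * (delta / eps) <= h * cost P eps pi x.
  by move=> Dx; rewrite ler_pM2l // cost_shallow.
(* Outside the inner box T >= X covers the gap and the penalty covers X E. *)
have [xbox|xbox] := pselect (box d (L - h) x); last first.
  have x0 := depth_outside xbox.
  have D0 := DL_gt0 hmargin.
  have {}hcost : h * (delta / eps) <= h * cost P eps pi x by apply: hcost; rewrite x0 ltW.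
  have XT : X * 1 <= T.
    apply: T_ge; apply: le_trans (Aop_barrier_locally_max Ppi _); last first.
      by move=> y _; exact: barrier_le_surface.
    (* If DL < h the minimum is negative, but the barrier is at least 1 at depth 0 in either
       case. *)
    rewrite ler_pM2l // -expR0 ler_expR oppr_ge0 pmulr_rle0 ?kappa_gt0 // x0.
    by rewrite ge_min lexx.
  have GX : (1 + h) * G <= X.
    by rewrite /X ler_pM2l ?addr_gt0 // greedy_gap_vval_le.
  have : 0 < (1 + h) * eta by rewrite mulr_gt0 ?addr_gt0.
  by lra.
have Geta : (1 + h) * G <= (1 + h) * eta by rewrite ler_pM2l ?addr_gt0 // Hgap.
(* In the shallow layer T >= 0 and the penalty covers X E; deeper, the barrier is constant on the
   stencil and T itself covers X E. *)
have [Dx|Dx] := leP (depth x) DL; first by have := hcost Dx; lra.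
have XT : X * E <= T.
  apply: T_ge; rewrite -(@barrier_deep x); last by lra.
  apply: Aop_barrier_locally_max => // y xy.
  by rewrite !barrier_deep //; have := depth_neighbor xy; lra.
have : 0 <= h * cost P eps pi x.
  have /andP[p0 _] := pOmega_div_bounds hP eps_gt0 x.
  apply: mulr_ge0; first exact: ltW.
  by apply: addr_ge0 => //; exact: (f_ge0 hP x (Ppi.2 x)).
by lra.
Qed.

End Barrier.

(** * The gap bound and the localization error *)

Theorem theorem5p10 (R : realType) (d m : nat) (P : problem R d m)
    (hP : standing P)
    (r1 nu0 COmega : R) (dtil : 'rV[R]_d -> R) (pibar : 'rV[R]_d -> 'rV[R]_m)
    (hpibar : inward_feedback P r1 nu0 COmega dtil pibar)
    (Cstar h0 : R) (hleak : leakage_constants P pibar Cstar h0)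
    (eps h L : R) (h_gt0 : 0 < h) (hL : h < L)
    (hbox : closure (Omega P) `<=` interior (box d L))
    (K : set 'rV[R]_d) (hKcpt : compact K) (hKsub : K `<=` closure (Omega P))
    (delta DL : R) (hmargin : margin P h L K delta DL)
    (hh : h <= Num.min h0 eps) (heps : eps <= 1)
    (hlam : lam P * h <= 2 * d%:R * visc P)
    (hDLh : 0 < DLh P h L delta - 2 * h)
    (hexp : 2 <= expR (lam P * (DLh P h L delta - 2 * h) / (4 * d%:R * visc P))) :
  (gext P eps h L pibar <= (Cext P / (eps * h))%:E)%E /\
  (expR (- (lam P * DL / (4 * d%:R * visc P))) <= delta * h ^+ 2 / (24 * Cext P) ->
   forall x, K x ->
     0 <= vLstar P eps h L pibar x - vval P eps h x
       <= h * (fsup P / lam P + Cstar)).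
Proof.
have Ppibar := pibar_policy hpibar.
have [hh0 hheps] : h <= h0 /\ h <= eps by move: hh; rewrite le_min => /andP.
have eps_gt0 : 0 < eps := lt_le_trans h_gt0 hheps.
have h1 : h <= 1 := le_trans hheps heps.
split=> [|small x Kx].
  apply: ge_ereal_sup => _ [x _ <-]; rewrite lee_fin.
  exact: (greedy_gap_vval_le hP).
have l0 := lam_gt0 hP; have h1_gt0 : 0 < 1 + h by rewrite addr_gt0.
have pibarL : PiL P h L pibar pibar by [].
have v_lb : lbound [set Sval P eps h pi x | pi in PiL P h L pibar] (vval P eps h x).
  by move=> _ [pi [Ppi _] <-]; exact: (vval_le_Sval hP).
have vL_ge : vval P eps h x <= vLstar P eps h L pibar x.
  by apply: lb_le_inf => //; exists (Sval P eps h pibar x); exists pibar.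
rewrite subr_ge0 vL_ge /=.
(* The inward feedback is a competitor, and h <= eps turns the leakage Cstar h / eps into Cstar. *)
have v_le : vval P eps h x <= fsup P / lam P + Cstar.
  apply: le_trans (vval_le_Sval hP h_gt0 eps_gt0 x Ppibar) _.
  apply: le_trans (leakage hleak h_gt0 hh0 eps_gt0 (hKsub x Kx)) _.
  rewrite lerD2l ler_pdivrMr // ler_pM2l //.
  by apply: lt_le_trans (Cstar_ge1 hleak).
suff vL_le : vLstar P eps h L pibar x <= (1 + h) * vval P eps h x.
  by have := ler_wpM2l (ltW h_gt0) v_le; lra.
apply/ler_addgt0Pr => e e0.
(* This tolerance makes the excess (1 + h) eta / lam equal to e. *)
have eta0 : 0 < e * lam P / (1 + h) by rewrite divr_gt0 ?mulr_gt0.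
have [pi PiLpi gap] := near_greedy_policy hP h_gt0 eps_gt0 hL Ppibar eta0.
apply: (@le_trans _ _ (Sval P eps h pi x)).
  by apply: ge_inf; [exists (vval P eps h x)|exists pi].
have := near_greedy_value hP h_gt0 eps_gt0 hL hmargin hlam Ppibar h1 heps small
  eta0 PiLpi gap Kx.
suff -> : (1 + h) * (e * lam P / (1 + h)) / lam P = e by [].
by field; rewrite !gt_eqF.
Qed.
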